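(* Let $k\in\mathbb C$, $k\neq0,-1$, $j\in\mathbb C$, $r\in\mathbb Z$, and put $p=\mathsf p_2(r,j,k)=-j+\frac k2-r(k+1)$ and $\ell_{\rm ch}(r',h,k)=r'[(r'-1)(k+1)+h]$. Let $|p,j,k;\tfrac12\rangle=|k-2p,\ell_{\rm ch}(-r,k-2p,k),k\rangle_{N=2}\otimes|e^{\frac{2j}k(U-F)}\rangle\otimes|0\rangle_{\psi\bar\psi}$ be the Ramond-sector $s\ell(2|1)$ highest-weight state in the realization of $s\ell(2|1)$ given in the context (here $\ell_{\rm ch}(-r,k-2p,k)=-\frac{(j+p-\frac k2)(1-j+\frac k2+p)}{1+k}$). Then the charged-II singular vectors mapped into the Ramond sector, $$|E(r,j,k)\rangle^{(2),(R)}_{\rm ch}=\begin{cases}E^2_{r}\cdots E^2_{-1}\cdot F^1_{r+1}\cdots F^1_{0}\,|p,j,k;\tfrac12\rangle,&r\le-1,\\ E^1_{-r}\cdots E^1_{-1}\cdot F^2_{-r}F^2_{-r+1}\cdots F^2_0\,|p,j,k;\tfrac12\rangle,&r\ge0\end{cases}$$ (mode numbers increasing by $1$ from left to right), evaluate as charged $N=2$ singular vectors tensored with free-field vacua: for $r\le-1$, $$|E(r,j,k)\rangle^{(2),(R)}_{\rm ch}=\mathcal G_r\cdots\mathcal G_{-1}|k-2p,\ell_{\rm ch}(-r,k-2p,k),k\rangle_{N=2}\otimes|e^{\frac{2j}k(U-F)}\rangle\otimes\bar\psi_r\cdots\bar\psi_{-1}|0\rangle_{\psi\bar\psi},$$ and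 for $r\ge0$, $$|E(r,j,k)\rangle^{(2),(R)}_{\rm ch}=(-1)^r\Bigl(\frac{k+1}2\Bigr)^{r+1}\mathcal Q_{-r}\cdots\mathcal Q_0|k-2p,\ell_{\rm ch}(-r,k-2p,k),k\rangle_{N=2}\otimes|e^{\frac{2j}k(U-F)}\rangle\otimes\psi_{-r+1}\cdots\psi_0|0\rangle_{\psi\bar\psi}.$$ Here $\bar\psi_r\cdots\bar\psi_{-1}|0\rangle_{\psi\bar\psi}$ and $\psi_{-r+1}\cdots\psi_0|0\rangle_{\psi\bar\psi}$ represent the ''$r$''-vacua of the $\psi\bar\psi$ theory.
   Context: $N=2$ algebra (twisted form): generators $\mathcal L_n,\mathcal H_n$ (even), $\mathcal G_n,\mathcal Q_n$ (odd), $n\in\mathbb Z$, with $[\mathcal L_m,\mathcal L_n]=(m-n)\mathcal L_{m+n}$, $[\mathcal H_m,\mathcal H_n]=\frac{\mathsf c}3m\delta_{m+n,0}$, $[\mathcal L_m,\mathcal G_n]=(m-n)\mathcal G_{m+n}$, $[\mathcal H_m,\mathcal G_n]=\mathcal G_{m+n}$, $[\mathcal L_m,\mathcal Q_n]=-n\mathcal Q_{m+n}$, $[\mathcal H_m,\mathcal Q_n]=-\mathcal Q_{m+n}$, $[\mathcal L_m,\mathcal H_n]=-n\mathcal H_{m+n}+\frac{\mathsf c}6(m^2+m)\delta_{m+n,0}$, $\{\mathcal G_m,\mathcal Q_n\}=2\mathcal L_{m+n}-2n\mathcal H_{m+n}+\frac{\mathsf c}3(m^2+m)\delta_{m+n,0}$,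 with $\mathsf c=-3-6k$. Fields: $\mathcal T(z)=\sum\mathcal L_nz^{-n-2}$, $\mathcal G(z)=\sum\mathcal G_nz^{-n-2}$, $\mathcal Q(z)=\sum\mathcal Q_nz^{-n-1}$, $\mathcal H(z)=\sum\mathcal H_nz^{-n-1}$ (sums over $\mathbb Z$). The vector $|h,\ell,k\rangle_{N=2}$ is the highest-weight vector of the $N=2$ Verma module: annihilated by $\mathcal Q_{\ge1},\mathcal G_{\ge0},\mathcal L_{\ge1},\mathcal H_{\ge1}$, with $\mathcal H_0=h$, $\mathcal L_0=\ell$ on it. The charged $N=2$ singular vector with label $r'$ (existing for $\ell=\ell_{\rm ch}(r',h,k)$) is $\mathcal Q_{r'}\cdots\mathcal Q_0|h,\ell,k\rangle_{N=2}$ for $r'\le-1$ and $\mathcal G_{-r'}\cdots\mathcal G_{-1}|h,\ell,k\rangle_{N=2}$ for $r'\ge1$. Free fields: $\partial F(z)\partial F(w)\sim\frac{-k/2}{(z-w)^2}$, $\partial U(z)\partial U(w)\sim\frac{k/2}{(z-w)^2}$, $\psi(z)\bar\psi(w)\sim\frac1{z-w}$, all other products among them and with the $N=2$ fields being trivial. $|e^{a(U-F)}\rangle$ is the primary state corresponding to the vertex operator $e^{a(U-F)}$, i.e. the Fock vacuum annihilated by the positive modes of $\partial F,\partial U$, with zero modes $(\partial U)_0=(\partial F)_0=ka/2$. $\psi(z)=\sum_{n\in\mathbb Z}\psi_nz^{-n}$, $\bar\psi(z)=\sum_{n\in\mathbb Z}\bar\psi_nz^{-n-1}$, $\psi_{\ge1}|0\rangle_{\psi\bar\psi}=\bar\psi_{\ge0}|0\rangle_{\psi\bar\psi}=0$.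 Realization of the level-$k$ affine $s\ell(2|1)$ currents $C(z)=\sum_{n\in\mathbb Z}C_nz^{-n-1}$ (only the fermionic ones are needed here): $E^1=\psi e^{\frac1k(U-F)}$, $E^2=\bar\psi e^{\frac1k(U-F)}$, $F^1=(\mathcal G-\bar\psi\,\partial F-\frac12\mathcal H\bar\psi-(k+\frac12)\partial\bar\psi)e^{-\frac1k(U-F)}$, $F^2=(\frac12(k+1)\mathcal Q+\psi\,\partial F-\frac12\mathcal H\psi+(k+\frac12)\partial\psi)e^{-\frac1k(U-F)}$, where every term is multiplied by the vertex operator and normal ordered, nested from right to left as $:\!A:\!BC\!:\,:$.
   Formalization: For r≥0 the right-hand side carries |e^{((2j-1)/k)(U-F)}⟩ instead of the printed |e^{(2j/k)(U-F)}⟩, which is false since r factors E^1 and r+1 factors F^2 shift the momentum by -1/k; the N=2 highest-weight vector is taken odd to fix signs. *)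

(* Defs.v *)
From HB Require Import structures.
From mathcomp Require Import all_boot all_order all_algebra.
From mathcomp Require Import finmap multiset monalg complex.
From mathcomp Require Import boolp classical_sets fsbigop reals.

Set Implicit Arguments.
Unset Strict Implicit.
Unset Printing Implicit Defensive.

Import Order.TTheory GRing.Theory Num.Theory.
Local Open Scope ring_scope.

(* A field A(z) = \sum_n A n * z^(-n-1) is given by its modes A : int -> T -> T;
   in the definitions on fields, the index always refers to this convention,
   whatever the customary labelling of the modes of that field. *)

Section Fields.
Context {C : fieldType} {T : lmodType C}.
Implicit Types (A B : int -> T -> T) (x : T).

(* :A B:(z) = A_-(z) B(z) + B(z) A_+(z), with A_-(z) the nonnegative powers
   of z; the sign of the second term is the one for A or B even.  The sums
   over finitely supported families are finite on the vectors considered. *)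
Definition nop A B (n : int) x : T :=
  \sum_(i \in [set i : int | i < 0]%classic) A i (B (n - 1 - i) x)
  + \sum_(i \in [set i : int | 0 <= i]%classic) B (n - 1 - i) (A i x).

Definition dfield A (n : int) x : T := (- n%:~R) *: A (n - 1) x.

(* A_m A_(m+1) ... A_n x, equal to x when n < m *)
Definition modes A (m n : int) x : T :=
  foldr (fun i y => A (m + i%:Z) y) x
    (iota 0 (if m <= n then `|n - m|%N.+1 else 0%N)).

(* coefficient of z^n in (\sum_(m >= 1) A m z^m)^q *)
Fixpoint series_pow (A : nat -> T -> T) (q n : nat) x : T :=
  if q is q'.+1 then \sum_(i < n) A i.+1 (series_pow A q' (n - i.+1) x)
  else if n == 0%N then x else 0.

(* coefficient of z^n in exp (\sum_(m >= 1) A m z^m) *)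
Definition series_exp (A : nat -> T -> T) (n : nat) x : T :=
  \sum_(q < n.+1) (q`!%:R)^-1 *: series_pow A q n x.

End Fields.

Section N2.
Variable C : fieldType.

Definition comm (T : zmodType) (A B : T -> T) x := A (B x) - B (A x).
Definition acomm (T : zmodType) (A B : T -> T) x := A (B x) + B (A x).

(* Z/2-graded modules of central charge c; n2par is +1 on even vectors and
   -1 on odd ones. *)
Record n2rep (c : C) (V : lmodType C) := N2Rep {
  n2L : int -> {linear V -> V};
  n2H : int -> {linear V -> V};
  n2G : int -> {linear V -> V};
  n2Q : int -> {linear V -> V};
  n2par : {linear V -> V};
  n2LL : forall m n x, comm (n2L m) (n2L n) x = (m - n)%:~R *: n2L (m + n) x;
  n2HH : forall m n x, comm (n2H m) (n2H n) x =
    (c / 3%:R * m%:~R * (m + n == 0)%:R) *: x;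
  n2LG : forall m n x, comm (n2L m) (n2G n) x = (m - n)%:~R *: n2G (m + n) x;
  n2HG : forall m n x, comm (n2H m) (n2G n) x = n2G (m + n) x;
  n2LQ : forall m n x, comm (n2L m) (n2Q n) x = (- n)%:~R *: n2Q (m + n) x;
  n2HQ : forall m n x, comm (n2H m) (n2Q n) x = - n2Q (m + n) x;
  n2LH : forall m n x, comm (n2L m) (n2H n) x = (- n)%:~R *: n2H (m + n) x
    + (c / 6%:R * (m ^+ 2 + m)%:~R * (m + n == 0)%:R) *: x;
  n2GQ : forall m n x, acomm (n2G m) (n2Q n) x =
    2%:R *: n2L (m + n) x - (2 * n)%:~R *: n2H (m + n) x
    + (c / 3%:R * (m ^+ 2 + m)%:~R * (m + n == 0)%:R) *: x;
  n2GG : forall m n x, acomm (n2G m) (n2G n) x = 0;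
  n2QQ : forall m n x, acomm (n2Q m) (n2Q n) x = 0;
  n2parK : forall x, n2par (n2par x) = x;
  n2parL : forall n x, n2par (n2L n x) = n2L n (n2par x);
  n2parH : forall n x, n2par (n2H n x) = n2H n (n2par x);
  n2parG : forall n x, n2par (n2G n x) = - n2G n (n2par x);
  n2parQ : forall n x, n2par (n2Q n x) = - n2Q n (n2par x)
}.

(* The parity of |h, l, k> is a convention.  It is taken odd: this decides the
   sign with which a free fermion crosses the N=2 factor of a tensor product
   (see onFer), hence the signs in formulas for vectors of that product. *)
Definition n2_hw c (V : lmodType C) (rho : n2rep c V) (h l : C) (v : V) :=
  [/\ forall n : int, 1 <= n -> n2Q rho n v = 0,
      forall n : int, 0 <= n -> n2G rho n v = 0,
      forall n : int, 1 <= n -> n2L rho n v = 0 /\ n2H rho n v = 0,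
      n2H rho 0 v = h *: v /\ n2L rho 0 v = l *: v
    & n2par rho v = - v].

Definition n2_hom c (V W : lmodType C) (rho : n2rep c V) (sigma : n2rep c W)
    (f : {linear V -> W}) :=
  [/\ forall n x, f (n2L rho n x) = n2L sigma n (f x),
      forall n x, f (n2H rho n x) = n2H sigma n (f x),
      forall n x, f (n2G rho n x) = n2G sigma n (f x),
      forall n x, f (n2Q rho n x) = n2Q sigma n (f x)
    & forall x, f (n2par rho x) = n2par sigma (f x)].

(* (V, v) is the Verma module: the universal highest-weight module. *)
Definition n2_verma c (V : lmodType C) (rho : n2rep c V) (h l : C) (v : V) :=
  n2_hw rho h l v /\
  forall (W : lmodType C) (sigma : n2rep c W) (w : W), n2_hw sigma h l w ->
    (exists2 f : {linear V -> W}, n2_hom rho sigma f & f v = w) /\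
    (forall f g : {linear V -> W}, n2_hom rho sigma f -> n2_hom rho sigma g ->
      f v = w -> g v = w -> f =1 g).

End N2.

Section FreeFields.
Variables (C : fieldType) (k : C).

Definition linext (I : choiceType) (T : lmodType C) (phi : I -> T)
    (x : {malg C[I]}) : T :=
  \sum_(i <- msupp x) x@_i *: phi i.

(* The basis vector (a, f, u) is the product of the creation operators
   dF_(-i-1), i in f, and dU_(-i-1), i in u, applied to |e^(a(U-F))>. *)
Definition bos_idx : choiceType := (C * {mset nat}%mset * {mset nat}%mset)%type.
Definition bos : lmodType C := {malg C[bos_idx]}.

Definition bos_vac (a : C) : bos := << ((a, mset0, mset0) : bos_idx) >>.

(* [dF_m, dF_n] = - (k/2) m delta_(m+n,0) *)
Definition dF (n : int) : bos -> bos := linext (fun x : bos_idx =>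
  let: (a, f, u) := x in
  match n with
  | Negz i => << ((a, i +` f, u)%mset : bos_idx) >> : bos
  | Posz 0 => (k * a / 2%:R) *: << x >>
  | Posz i.+1 => (- (k / 2%:R) * i.+1%:R * (f i)%:R)
                 *: << ((a, f `\ i, u)%mset : bos_idx) >>
  end).

(* [dU_m, dU_n] = (k/2) m delta_(m+n,0) *)
Definition dU (n : int) : bos -> bos := linext (fun x : bos_idx =>
  let: (a, f, u) := x in
  match n with
  | Negz i => << ((a, f, i +` u)%mset : bos_idx) >> : bos
  | Posz 0 => (k * a / 2%:R) *: << x >>
  | Posz i.+1 => (k / 2%:R * i.+1%:R * (u i)%:R)
                 *: << ((a, f, u `\ i)%mset : bos_idx) >>
  end).

Definition dUF (n : int) (x : bos) : bos := dU n x - dF n x.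

Definition bos_shift (a : C) : bos -> bos := linext (fun x : bos_idx =>
  let: (b, f, u) := x in << ((b + a, f, u) : bos_idx) >> : bos).

(* e^(a(U-F))(z) = shift * exp (a \sum_(m>=1) dUF_(-m) z^m / m)
                         * exp (- a \sum_(m>=1) dUF_m z^(-m) / m);
   the factor z^(a dUF_0) is 1, since dUF_0 = 0 on bos. *)
Definition vertex (a : C) (n : int) (x : bos) : bos :=
  \sum_(i \in [set i : nat * nat | i.1%:Z - i.2%:Z = - n - 1]%classic)
    bos_shift a
      (series_exp (fun m y => (a / m%:R) *: dUF (- m%:Z) y) i.1
        (series_exp (fun m y => (- a / m%:R) *: dUF m%:Z y) i.2 x)).

(* The basis vector (A, B), A = {a1 < a2 < ...}, B = {b1 < b2 < ...}, is
   psi_(-a1) psi_(-a2) ... psibar_(-b1-1) psibar_(-b2-1) ... |0>. *)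
Definition fer_idx : choiceType := ({fset nat} * {fset nat})%type.
Definition fer : lmodType C := {malg C[fer_idx]}.

Definition fer_vac : fer := << ((fset0, fset0) : fer_idx) >>.

Definition nbelow (A : {fset nat}) (a : nat) : nat := count (fun b => b < a)%N A.

Definition psi_create (a : nat) (x : fer_idx) : fer :=
  if a \in x.1 then 0 else
  (-1) ^+ nbelow x.1 a *: << ((a |` x.1, x.2)%fset : fer_idx) >>.

Definition psi_destroy (a : nat) (x : fer_idx) : fer :=
  if a \in x.1 then
    (-1) ^+ nbelow x.1 a *: << ((x.1 `\ a, x.2)%fset : fer_idx) >>
  else 0.

Definition psibar_create (b : nat) (x : fer_idx) : fer :=
  if b \in x.2 then 0 else
  (-1) ^+ (#|` x.1| + nbelow x.2 b) *: << ((x.1, b |` x.2)%fset : fer_idx) >>.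

Definition psibar_destroy (b : nat) (x : fer_idx) : fer :=
  if b \in x.2 then
    (-1) ^+ (#|` x.1| + nbelow x.2 b) *: << ((x.1, x.2 `\ b)%fset : fer_idx) >>
  else 0.

(* {psi_m, psibar_n} = delta_(m+n,0), with psi(z) = \sum_n psi_n z^(-n) and
   psibar(z) = \sum_n psibar_n z^(-n-1) *)
Definition psi (n : int) : fer -> fer := linext (fun x : fer_idx =>
  match n with
  | Posz 0 => psi_create 0 x
  | Negz i => psi_create i.+1 x
  | Posz i.+1 => psibar_destroy i x
  end).

Definition psibar (n : int) : fer -> fer := linext (fun x : fer_idx =>
  match n with
  | Negz i => psibar_create i x
  | Posz i => psi_destroy i x
  end).

End FreeFields.

Section TensorSpace.
Variables (C : fieldType) (V : lmodType C).

(* V (x) bos (x) fer, as the finitely supported families of vectors of V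
   indexed by the basis of bos (x) fer *)
Definition tspace : Type := {malg V[(bos_idx C * fer_idx)%type]}.
HB.instance Definition _ := GRing.Zmodule.on tspace.
Implicit Types w : tspace.

Definition tscale (c : C) w : tspace := [malg i in msupp w => c *: w@_i].

Lemma tscaleE c w i : (tscale c w)@_i = c *: w@_i.
Proof.
rewrite /tscale mcoeffE; case: msuppP => // _.
by rewrite scaler0.
Qed.

Fact tscaleA a b w : tscale a (tscale b w) = tscale (a * b) w.
Proof. by apply/malgP => i; rewrite !tscaleE scalerA. Qed.

Fact tscale1 : left_id 1 tscale.
Proof. by move=> w; apply/malgP => i; rewrite tscaleE scale1r. Qed.

Fact tscaleDr : right_distributive tscale +%R.
Proof. by move=> c w w'; apply/malgP => i; rewrite !(tscaleE, mcoeffD) scalerDr. Qed.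

Fact tscaleDl w : {morph tscale^~ w : a b / a + b}.
Proof. by move=> a b; apply/malgP => i; rewrite !(tscaleE, mcoeffD) scalerDl. Qed.

HB.instance Definition _ := GRing.Zmodule_isLmodule.Build C tspace
  tscaleA tscale1 tscaleDr tscaleDl.

Definition tens (v : V) (b : bos C) (y : fer C) : tspace :=
  \sum_(i <- msupp b) \sum_(l <- msupp y) << (b@_i * y@_l) *: v *g (i, l) >>.

Definition onV (S : V -> V) w : tspace :=
  \sum_(i <- msupp w) tens (S w@_i) << i.1 >> << i.2 >>.

Definition onBos (S : bos C -> bos C) w : tspace :=
  \sum_(i <- msupp w) tens w@_i (S << i.1 >>) << i.2 >>.

(* 1 (x) 1 (x) S for an odd S: by the sign rule, S (v (x) b (x) y) =
   (-1)^|v| v (x) b (x) S y, where par v = (-1)^|v| v. *)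
Definition onFer (par : V -> V) (S : fer C -> fer C) w : tspace :=
  \sum_(i <- msupp w) tens (par w@_i) << i.1 >> (S << i.2 >>).

End TensorSpace.

Section Realization.
Variables (C : fieldType) (k : C) (V : lmodType C).
Variable rho : n2rep (- 3%:R - 6%:R * k) V.
Implicit Types (n : int) (w : tspace V).

Definition fieldG n w := onV (n2G rho (n - 1)) w.
Definition fieldQ n w := onV (n2Q rho n) w.
Definition fieldH n w := onV (n2H rho n) w.
Definition fieldF n w : tspace V := onBos (dF k n) w.
Definition fieldV (a : C) n w : tspace V := onBos (vertex k a n) w.
Definition fieldpsi n w := onFer (n2par rho) (@psi C (n + 1)) w.
Definition fieldpsibar n w := onFer (n2par rho) (@psibar C n) w.

Definition curE1 n w : tspace V := nop fieldpsi (fieldV k^-1) n w.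
Definition curE2 n w : tspace V := nop fieldpsibar (fieldV k^-1) n w.

Definition curF1 n w : tspace V :=
  nop fieldG (fieldV (- k^-1)) n w
  - nop fieldpsibar (nop fieldF (fieldV (- k^-1))) n w
  - 2%:R^-1 *: nop fieldH (nop fieldpsibar (fieldV (- k^-1))) n w
  - (k + 2%:R^-1) *: nop (dfield fieldpsibar) (fieldV (- k^-1)) n w.

Definition curF2 n w : tspace V :=
  ((k + 1) / 2%:R) *: nop fieldQ (fieldV (- k^-1)) n w
  + nop fieldpsi (nop fieldF (fieldV (- k^-1))) n w
  - 2%:R^-1 *: nop fieldH (nop fieldpsi (fieldV (- k^-1))) n w
  + (k + 2%:R^-1) *: nop (dfield fieldpsi) (fieldV (- k^-1)) n w.

(* |p, j, k; 1/2>, for v the highest-weight vector of weight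
   (k - 2p, lch (- r) (k - 2p) k) *)
Definition ramond_hw (j : C) (v : V) : tspace V :=
  tens v (bos_vac (2%:R * j / k)) (fer_vac C).

(* E1, E2 shift the boson momentum a by 1/k and F1, F2 by -1/k.  For r <= -1 the
   shifts cancel; for r >= 0 there are r factors E1 and r + 1 factors F2, and
   the momentum becomes 2j/k - 1/k. *)
Definition chargedII (r : int) (j : C) (v : V) : tspace V :=
  if r <= -1
  then modes curE2 r (-1) (modes curF1 (r + 1) 0 (ramond_hw j v))
  else modes curE1 (- r) (-1) (modes curF2 (- r) 0 (ramond_hw j v)).

End Realization.

Definition p2 (C : fieldType) (r : int) (j k : C) : C :=
  - j + k / 2%:R - r%:~R * (k + 1).

Definition lch (C : fieldType) (r' : int) (h k : C) : C :=
  r'%:~R * ((r' - 1)%:~R * (k + 1) + h).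

(* Main.v *)
Require Import Defs.
From HB Require Import structures.
From mathcomp Require Import all_boot all_order all_algebra.
From mathcomp Require Import finmap multiset monalg complex.
From mathcomp Require Import boolp classical_sets fsbigop reals.
From mathcomp Require Import zify ring.

(* Write chi for psibar and X for G if r <= -1, and chi for psi and X for Q if
   r >= 0, so that the two currents are E = chi V and
   F = al X W + be chi :dF W: + ga H chi W + de (d chi) W
   with V, W = e^(+-(U-F)/k).  The key point is that the modes E_m and F_n
   anticommute: all constituents (anti)commute except dF and V, whose commutator
   is V/2, and this contributes a sum \sum_(i, j) chi_i chi_j Y_(q-i-j), which
   vanishes by antisymmetry.  Hence the modes of E can be moved to the right of
   those of F, where they act on the vacua and produce chi_(-s) ... chi_(-1) |0>.
   On such a state F_(-n), n < s, reduces to al X_(-n): its other terms are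
   proportional to chi_(-n-1), which is already present.  For r >= 0 there is one
   more factor F_(-s), whose chi_(-s-1) term has a coefficient that is zero by
   the choice of p.
   The sums in the normal ordered products are finite on the whole Verma module,
   because the vectors killed by all modes of large index form a submodule
   containing the highest-weight vector. *)

Set Implicit Arguments.
Unset Strict Implicit.
Unset Printing Implicit Defensive.

Import Order.TTheory GRing.Theory Num.Theory.
Local Open Scope ring_scope.

(** * Fields on a module *)

(** The combination [U - F] is null: the cocycles of [dU] and [dF] have opposite signs, so the modes
    of [dUF] commute, and with them all vertex operators. The factor 1/2 in the commutator of [dF]
    with V is (k/2)(1/k). A sum [\sum_(i \in A)] with infinite support is 0 by convention, so no
    normal ordered product can be rearranged before its local finiteness is known. Every family of
    operators therefore comes with a proof that its modes of large index kill each given vector: on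
    the bosons by a level bound, on the fermions by the finiteness of the index sets, and on the
    Verma module, of which no basis is given, by universality. The sign in the result has two
    sources: exchanging s modes of E with t modes of F gives s t signs, and each mode of E carries a
    fermion across the odd vector v, which gives s more. The total s t + s is even for t = s and has
    the parity of s for t = s + 1. *)

Section LinearFunctions.
Context {C : pzRingType} {T T' : lmodType C} {f : T -> T'} (lf : linear f).

Lemma lin0 : f 0 = 0.
Proof. by have := lf (-1) 0 0; rewrite scaler0 addr0 scaleN1r addNr. Qed.

Lemma linZ a x : f (a *: x) = a *: f x.
Proof. by have := lf a x 0; rewrite lin0 !addr0. Qed.

Lemma linD x y : f (x + y) = f x + f y.
Proof. by have := lf 1 x y; rewrite !scale1r. Qed.

Lemma linN x : f (- x) = - f x.
Proof. by rewrite -!scaleN1r linZ. Qed.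

Lemma lin_sum (I : Type) (r : seq I) (P : pred I) (F : I -> T) :
  f (\sum_(i <- r | P i) F i) = \sum_(i <- r | P i) f (F i).
Proof. by apply: (big_morph f linD lin0). Qed.

End LinearFunctions.

Lemma linear_comp (C : pzRingType) (T T' T'' : lmodType C) (f : T' -> T'')
  (g : T -> T') : linear f -> linear g -> linear (f \o g).
Proof. by move=> lf lg a x y; rewrite /= lg lf. Qed.

Lemma linear_sum_fun (C : comPzRingType) (T T' : lmodType C) (I : Type)
    (r : seq I) (P : pred I) (F : I -> T -> T') :
  (forall i, linear (F i)) -> linear (fun x => \sum_(i <- r | P i) F i x).
Proof.
move=> lF a x y; rewrite scaler_sumr -big_split /=.
by apply: eq_bigr => i _; rewrite lF.
Qed.

Lemma linear_scale_fun (C : comPzRingType) (T T' : lmodType C) (c : C)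
    (f : T -> T') :
  linear f -> linear (fun x => c *: f x).
Proof. by move=> lf a x y; rewrite lf scalerDr !scalerA mulrC. Qed.

(** * Finite sums over the integers *)

Section IntegerSums.
Context {T : zmodType}.
Implicit Types f g : int -> T.

Definition zrange (N : nat) : seq int :=
  [seq i%:Z - N%:Z | i <- iota 0 N.*2.+1].

Lemma mem_zrange N (i : int) : (i \in zrange N) = (`|i| <= N)%N.
Proof.
apply/mapP/idP => [[j + ->]|iN]; first by rewrite mem_iota; lia.
by exists (absz (i + N%:Z)); [rewrite mem_iota|]; lia.
Qed.

Lemma uniq_zrange N : uniq (zrange N).
Proof. by rewrite map_inj_uniq ?iota_uniq// => i j; lia. Qed.

Definition fsupp f := exists N, forall i : int, (N < `|i|)%N -> f i = 0.

Definition zsum f : T := \sum_(i \in [set: int]%classic) f i.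

Lemma fsum_zrange (A : set int) f N :
  (forall i : int, (N < `|i|)%N -> f i = 0) ->
  \sum_(i \in A) f i = \sum_(i <- zrange N | i \in A) f i.
Proof.
move=> fN; rewrite [RHS]bigfs ?uniq_zrange ?set_mem_set// => i _.
by rewrite mem_zrange -ltnNge => /fN.
Qed.

Lemma zsumE f N : (forall i : int, (N < `|i|)%N -> f i = 0) ->
  zsum f = \sum_(i <- zrange N) f i.
Proof.
move=> fN; rewrite /zsum (fsum_zrange _ fN).
by apply: eq_bigl => i; rewrite mem_set.
Qed.

Lemma eq_zsum f g : f =1 g -> zsum f = zsum g.
Proof. by move=> fg; apply: eq_fsbigr => i _. Qed.

Lemma zsum0 f : (forall i, f i = 0) -> zsum f = 0.
Proof. by move=> f0; apply: fsbig1. Qed.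

Lemma zsum_single f i0 : (forall i, i != i0 -> f i = 0) -> zsum f = f i0.
Proof.
move=> f0; rewrite (@zsumE _ `|i0|%N) => [|i iN].
  by rewrite (bigD1_seq i0) ?uniq_zrange ?mem_zrange//= big1 ?addr0.
by apply: f0; apply: contraTneq iN => ->; rewrite ltnn.
Qed.

Lemma zsumD f g : fsupp f -> fsupp g ->
  zsum (fun i => f i + g i) = zsum f + zsum g.
Proof.
move=> [M fM] [N gN]; rewrite !(@zsumE _ (maxn M N)) ?big_split// => i.
- by rewrite gtn_max => /andP[_ /gN].
- by rewrite gtn_max => /andP[/fM].
- by rewrite gtn_max => /andP[/fM -> /gN ->]; rewrite addr0.
Qed.

Lemma zsum_shift f m : zsum f = zsum (fun i => f (i + m)).
Proof.
apply: (reindex_fsbigT (fun i : int => i + m)).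
by exists (fun i => i - m) => i; rewrite (addrK, subrK).
Qed.

Lemma fsum_split f : fsupp f ->
  \sum_(i \in [set i : int | i < 0]%classic) f i
  + \sum_(i \in [set i : int | 0 <= i]%classic) f i = zsum f.
Proof.
move=> [N fN]; rewrite !(fsum_zrange _ fN) (zsumE fN).
rewrite [RHS](bigID (fun i => i < 0)) /=; congr (_ + _); apply: eq_bigl => i.
  by apply/idP/idP; rewrite inE.
by rewrite -leNgt; apply/idP/idP; rewrite inE.
Qed.

End IntegerSums.

Lemma fsupp_lin (C : pzRingType) (T T' : lmodType C) (phi : T -> T')
    (f : int -> T) :
  linear phi -> fsupp f -> fsupp (fun i => phi (f i)).
Proof. by move=> lphi [N fN]; exists N => i /fN ->; rewrite lin0. Qed.

Lemma zsum_lin (C : pzRingType) (T T' : lmodType C) (phi : T -> T')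
    (f : int -> T) :
  linear phi -> fsupp f -> phi (zsum f) = zsum (fun i => phi (f i)).
Proof.
move=> lphi [N fN]; rewrite (zsumE fN) (lin_sum lphi) (@zsumE _ _ N)// => i.
by move/fN ->; rewrite lin0.
Qed.

Lemma linear_scale (C : comPzRingType) (T : lmodType C) (a : C) :
  linear (fun x : T => a *: x).
Proof. by move=> b x y; rewrite scalerDr !scalerA mulrC. Qed.

Lemma fsuppZ (C : comPzRingType) (T : lmodType C) a (f : int -> T) :
  fsupp f -> fsupp (fun i => a *: f i).
Proof. exact/fsupp_lin/linear_scale. Qed.

Lemma zsumZ (C : comPzRingType) (T : lmodType C) a (f : int -> T) :
  fsupp f -> a *: zsum f = zsum (fun i => a *: f i).
Proof. exact/zsum_lin/linear_scale. Qed.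

(** * Truncated fields and their normal ordered products *)

Section FieldAlgebra.
Context {C : fieldType} {T : lmodType C}.
Implicit Types (A B D : int -> T -> T) (x : T) (n m : int).

(** In terms of series, [A(z) x] is a formal Laurent series: for each x it has finitely many
    negative powers of z. *)
Definition bounded A := forall x, exists N, forall n, N <= n -> A n x = 0.

Definition isfield A := (forall n, linear (A n)) /\ bounded A.

Lemma bounded_upto B (f : nat -> T) (m : nat) : bounded B ->
  exists N, forall i n, (i < m)%N -> N <= n -> B n (f i) = 0.
Proof.
move=> bB; elim: m => [|m [N IH]]; first by exists 0.
have [M BM] := bB (f m); exists (Num.max N M) => i n; rewrite ltnS ge_max.
by rewrite leq_eqVlt => /orP[/eqP-> /andP[_ /BM]//|im /andP[/(IH i n im)]].
Qed.

Lemma isfield_shift A m : isfield A -> isfield (fun n => A (n + m)).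
Proof.
move=> [lA bA]; split=> // x; have [N AN] := bA x.
by exists (N - m) => n Nn; apply: AN; lia.
Qed.

Lemma isfield_scale c A : isfield A -> isfield (fun n x => c *: A n x).
Proof.
move=> [lA bA]; split=> [n|x]; first exact: linear_scale_fun.
by have [N AN] := bA x; exists N => n /AN ->; rewrite scaler0.
Qed.

Lemma isfield_dfield A : isfield A -> isfield (dfield A).
Proof.
move=> [lA bA]; split=> [n|x]; first exact: linear_scale_fun.
have [N AN] := bA x; exists (N + 1) => n Nn.
by rewrite /dfield AN ?scaler0//; lia.
Qed.

(** Both halves of [nop] as one family over all integers, so that a normal ordered product is a
    single sum that can be handled termwise. *)
Definition nopt A B n x (i : int) : T :=
  if i < 0 then A i (B (n - 1 - i) x) else B (n - 1 - i) (A i x).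

Section Nop.
Variables (A B : int -> T -> T) (fA : isfield A) (fB : isfield B).

Let linA n : linear (A n). Proof. exact: fA.1. Qed.
Let linB n : linear (B n). Proof. exact: fB.1. Qed.

(** For i very negative the mode of B acting on x has large index; for i large [A i x] vanishes. *)
Lemma fsupp_nopt n x : fsupp (nopt A B n x).
Proof.
have [a Aa] := fA.2 x; have [b Bb] := fB.2 x.
exists (`|a| + `|n| + `|b| + 1)%N => i iN; rewrite /nopt; case: ifP => i0.
  by rewrite Bb ?lin0//; lia.
by rewrite Aa ?lin0//; lia.
Qed.

Lemma nopE n x : nop A B n x = zsum (nopt A B n x).
Proof.
rewrite -(fsum_split (fsupp_nopt n x)) /nop; congr (_ + _).
  by apply: eq_fsbigr => i; rewrite inE /= /nopt => ->.
by apply: eq_fsbigr => i; rewrite inE /= /nopt leNgt => /negPf ->.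
Qed.

(** For n large, the terms with i < 0 vanish because B then has index at least n. Those with i >= 0
    involve only the finitely many vectors [A i x] with i < a, for which [bounded_upto] gives a
    common bound. *)
Lemma isfield_nop : isfield (nop A B).
Proof.
split=> [n a x y|x].
  rewrite !nopE zsumZ -?zsumD; do ?[apply: fsuppZ|exact: fsupp_nopt].
  by apply: eq_zsum => i; rewrite /nopt; case: ifP; rewrite ?(linA, linB).
have [a Aa] := fA.2 x; have [b Bb] := fB.2 x.
have [c Bc] := @bounded_upto B (fun i => A i%:Z x) `|a| fB.2.
exists (`|b|%:Z + `|c|%:Z + `|a|%:Z + 1) => n nN.
rewrite nopE zsum0// => i; rewrite /nopt; case: ifP => i0.
  by rewrite Bb ?lin0//; lia.
have [ia|ai] := ltP i a; last by rewrite Aa// lin0.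
have -> : i = `|i|%N%:Z by lia.
by apply: Bc; lia.
Qed.

(** The scalars s and t are meant to be 1 or -1, according to whether F commutes or anticommutes
    with each factor. *)
Lemma nop_sign (F : T -> T) s t n x : linear F ->
  (forall i x, F (A i x) = s *: A i (F x)) ->
  (forall i x, F (B i x) = t *: B i (F x)) ->
  F (nop A B n x) = (s * t) *: nop A B n (F x).
Proof.
move=> linF FA FB; rewrite !nopE (zsum_lin linF (fsupp_nopt _ _)).
rewrite zsumZ; last exact: fsupp_nopt.
apply: eq_zsum => i; rewrite /nopt; case: ifP => _.
  by rewrite FA FB (linZ (linA _)) scalerA.
by rewrite FB FA (linZ (linB _)) scalerA mulrC.
Qed.

(** F acts as a derivation. In the applications A' is a multiple of a field with shifted index, and
    the correction is recognised as a shifted product once the shift is undone. *)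
Lemma nop_derl (F : T -> T) A' n x : linear F -> isfield A' ->
  (forall i x, F (A i x) = A i (F x) + A' i x) ->
  (forall i x, F (B i x) = B i (F x)) ->
  F (nop A B n x) = nop A B n (F x) + zsum (nopt A' B n x).
Proof.
move=> linF [linA' bA'] FA FB; rewrite !nopE (zsum_lin linF (fsupp_nopt _ _)).
rewrite -zsumD; last 2 first.
- exact: fsupp_nopt.
- have [a Aa] := bA' x; have [b Bb] := fB.2 x.
  exists (`|a| + `|n| + `|b| + 1)%N => i iN; rewrite /nopt; case: ifP => i0.
    by rewrite Bb ?lin0//; lia.
  by rewrite Aa ?lin0//; lia.
apply: eq_zsum => i; rewrite /nopt; case: ifP => _; first by rewrite FA FB.
by rewrite FB FA (linD (linB _)).
Qed.

Lemma nop_derr (F : T -> T) B' n x : linear F -> isfield B' ->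
  (forall i x, F (A i x) = A i (F x)) ->
  (forall i x, F (B i x) = B i (F x) + B' i x) ->
  F (nop A B n x) = nop A B n (F x) + zsum (nopt A B' n x).
Proof.
move=> linF [linB' bB'] FA FB; rewrite !nopE (zsum_lin linF (fsupp_nopt _ _)).
rewrite -zsumD; last 2 first.
- exact: fsupp_nopt.
- have [a Aa] := fA.2 x; have [b Bb] := bB' x.
  exists (`|a| + `|n| + `|b| + 1)%N => i iN; rewrite /nopt; case: ifP => i0.
    by rewrite Bb ?lin0//; lia.
  by rewrite Aa ?lin0//; lia.
apply: eq_zsum => i; rewrite /nopt; case: ifP => _; last by rewrite FB FA.
by rewrite FA FB (linD (linA _)).
Qed.

Hypothesis AB : forall i j x, A i (B j x) = B j (A i x).

Lemma nop_commE n x : nop A B n x = zsum (fun i => A i (B (n - 1 - i) x)).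
Proof. by rewrite nopE; apply: eq_zsum => i; rewrite /nopt AB; case: ifP. Qed.

Lemma fsupp_comm n x : fsupp (fun i => A i (B (n - 1 - i) x)).
Proof.
have [N zN] := fsupp_nopt n x; exists N => i /zN.
by rewrite /nopt AB; case: ifP.
Qed.

Lemma nop_single n x i0 : (forall i, i != i0 -> A i (B (n - 1 - i) x) = 0) ->
  nop A B n x = A i0 (B (n - 1 - i0) x).
Proof. by move=> /zsum_single; rewrite nop_commE. Qed.

Lemma nop_shiftl n m x :
  zsum (fun i => A (i + m) (B (n - 1 - i) x)) = nop A B (n + m) x.
Proof.
rewrite nop_commE [RHS](@zsum_shift _ _ m).
by apply: eq_zsum => i; congr (A _ (B _ _)); lia.
Qed.

End Nop.

(** The support of the inner sum depends on i; the point is that all nonzero terms lie in one finite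
    square, on which the two summations can be exchanged. *)
Lemma zsum_anticomm A D q x : (2%:R : C) != 0 -> isfield A -> isfield D ->
  (forall i j x, A i (A j x) = - A j (A i x)) ->
  (forall i j x, A i (D j x) = D j (A i x)) ->
  let f i := A i (zsum (fun j => A j (D (q - i - j) x))) in
  fsupp f /\ zsum f = 0.
Proof.
move=> two [linA bA] [linD bD] AA AD f.
have [a Aa] := bA x; have [d Dd] := bD x.
pose g i j := A i (A j (D (q - i - j) x)).
have gN i j : g j i = - g i j by rewrite /g AA; congr (- A _ (A _ (D _ _))); lia.
(* Let j lie outside the square. If j >= a, then [A j] moves to x and kills it. Otherwise j is very
   negative: either i >= a and [A i] kills x, or i < a and D has index at least d. *)
pose N := (`|a| + `|q| + `|d| + `|a|)%N.
have gl i j : (N < `|j|)%N -> g i j = 0.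
  rewrite /g => jN; have [ja|ja] := ltP j a; last first.
    by rewrite AD Aa// lin0// lin0.
  have [ia|ia] := ltP i a; first by rewrite Dd ?lin0//; rewrite /N in jN; lia.
  by rewrite AA AD Aa// !(lin0 (linA _), lin0 (linD _)) oppr0.
have gr i j : (N < `|i|)%N -> g i j = 0.
  by move=> iN; rewrite gN gl ?oppr0.
have fg i : f i = \sum_(j <- zrange N) g i j.
  rewrite /f zsum_lin//; first by rewrite (zsumE (gl i)).
  exists (`|a| + `|q| + `|d| + `|i|)%N => j jN.
  have [ja|ja] := ltP j a; first by rewrite Dd ?lin0//; lia.
  by rewrite AD Aa// lin0.
have fN i : (N < `|i|)%N -> f i = 0.
  by move=> iN; rewrite fg big1// => j _; apply: gr.
split; first by exists N.
have -> : zsum f = \sum_(i <- zrange N) \sum_(j <- zrange N) g i j.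
  by rewrite (zsumE fN); apply: eq_bigr => i _.
set S := \sum_(i <- _) _; suff /eqP : 2%:R *: S = 0.
  by rewrite scaler_eq0 (negPf two) => /eqP.
rewrite scaler_nat mulr2n {1}/S exchange_big -big_split big1//= => i _.
by rewrite -big_split big1//= => j _; rewrite gN addNr.
Qed.

End FieldAlgebra.

(** * Free modules and exponential series *)

Section FreeModule.
Context {C : numFieldType} {I : choiceType}.
Implicit Types x : {malg C[I]}.

Lemma big_msupp_widen (G : zmodType) (T : nmodType) (w : {malg G[I]})
    (D : {fset I}) (phi : I -> G -> T) :
  (forall i, phi i 0 = 0) -> (msupp w `<=` D)%fset ->
  \sum_(i <- msupp w) phi i w@_i = \sum_(i <- D) phi i w@_i.
Proof.
move=> phi0 wD; apply: big_fset_incl => // i _ /mcoeff_outdom ->.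
exact: phi0.
Qed.

Lemma malg_basis x : x = \sum_(i <- msupp x) x@_i *: << i >>.
Proof.
rewrite [LHS]monalgE; apply: eq_bigr => i _.
by apply/malgP => l; rewrite mcoeffZ !mcoeffU mulr_natr.
Qed.

Lemma linext_linear (T : lmodType C) (phi : I -> T) : linear (linext phi).
Proof.
move=> a x y; pose D := (msupp (a *: x + y) `|` (msupp x `|` msupp y))%fset.
pose psi i c := c *: phi i.
have psi0 i : psi i 0 = 0 by rewrite /psi scale0r.
rewrite /linext !(@big_msupp_widen _ _ _ D psi)//; last 3 first.
- by rewrite /D fsubsetU// fsubsetUr orbT.
- by rewrite /D fsubsetU// fsubsetUl orbT.
- by rewrite /D fsubsetUl.
rewrite scaler_sumr -big_split; apply: eq_bigr => i _ /=.
by rewrite /psi mcoeffD mcoeffZ scalerDl scalerA.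
Qed.

Lemma linextE (T : lmodType C) (phi : I -> T) i : linext phi << i >> = phi i.
Proof.
by rewrite /linext msuppU oner_eq0 big_seq_fset1 mcoeffUU scale1r.
Qed.

Lemma malg_eq (T : lmodType C) (f g : {malg C[I]} -> T) :
  linear f -> linear g -> (forall i, f << i >> = g << i >>) -> f =1 g.
Proof.
move=> lf lg fg x; rewrite [x]malg_basis (lin_sum lf) (lin_sum lg).
by apply: eq_bigr => i _; rewrite (linZ lf) (linZ lg) fg.
Qed.

End FreeModule.

Section LinearCombinators.
Context {C : comPzRingType} {T T' : lmodType C}.

Lemma linear_add (f g : T -> T') : linear f -> linear g ->
  linear (fun x => f x + g x).
Proof. by move=> lf lg a x y; rewrite lf lg scalerDr addrACA. Qed.

Lemma linear_id : linear (fun x : T => x).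
Proof. by []. Qed.

Lemma linear_zero : linear (fun _ : T => 0 : T').
Proof. by move=> a x y; rewrite scaler0 addr0. Qed.

End LinearCombinators.

(** * Powers and exponentials of operator series *)

Section Series.
Context {C : numFieldType} {T : lmodType C}.
Variable A : nat -> T -> T.
Hypothesis linA : forall m, linear (A m).

Lemma series_pow_linear q n : linear (series_pow A q n).
Proof.
elim: q n => [|q IH] n /=.
  by case: eqP => _; [exact: linear_id | exact: linear_zero].
apply: linear_sum_fun => i; exact: linear_comp.
Qed.

Lemma series_exp_linear n : linear (series_exp A n).
Proof.
apply: linear_sum_fun => q; apply: linear_scale_fun; exact: series_pow_linear.
Qed.

(** Every factor contributes degree at least 1, which is why [series_exp] may stop at q = n. *)
Lemma series_pow_lt q n x : (n < q)%N -> series_pow A q n x = 0.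
Proof.
elim: q n => [//|q IH] n nq /=; rewrite big1// => i _.
by rewrite IH ?lin0//; case: i => i /=; lia.
Qed.

(** Raising the truncation adds only vanishing powers; this lets coefficients of different degrees
    share one range of q. *)
Lemma series_expE M n x : (n <= M)%N ->
  series_exp A n x = \sum_(q < M.+1) (q`!%:R)^-1 *: series_pow A q n x.
Proof.
move=> nM; rewrite /series_exp.
rewrite (big_ord_widen M.+1 (fun q => (q`!%:R)^-1 *: series_pow A q n x))//.
rewrite [RHS](bigID (fun q : 'I_M.+1 => (q < n.+1)%N)) /= [X in _ = _ + X]big1.
  by rewrite addr0.
by move=> q; rewrite -leqNgt => nq; rewrite series_pow_lt ?scaler0.
Qed.

Lemma series_exp0 x : series_exp A 0 x = x.
Proof. by rewrite /series_exp big_ord1 /= invr1 scale1r. Qed.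

Lemma series_exp_vac n x : (forall m, A m.+1 x = 0) -> (0 < n)%N ->
  series_exp A n x = 0.
Proof.
move=> Ax n0; rewrite /series_exp big1// => q _.
suff -> : series_pow A q n x = 0 by rewrite scaler0.
move: n0; move: {q}(q : nat) => q.
elim: q n => [|q IH] n n0 /=; first by rewrite gtn_eqF.
rewrite big1// => i _; have [ni|ni] := posnP (n - i.+1); last first.
  by rewrite IH ?lin0.
by rewrite ni; case: q {IH} => [|q] /=; rewrite ?Ax// big_ord0 lin0.
Qed.

Section Commutation.
Variables (F : T -> T) (linF : linear F).

Lemma series_exp_comm n x : (forall m x, F (A m.+1 x) = A m.+1 (F x)) ->
  F (series_exp A n x) = series_exp A n (F x).
Proof.
move=> FA; rewrite /series_exp (lin_sum linF); apply: eq_bigr => q _.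
rewrite (linZ linF); congr (_ *: _); move: {q}(q : nat) => q.
elim: q n => [|q IH] n /=; first by case: eqP => // _; rewrite lin0.
by rewrite (lin_sum linF); apply: eq_bigr => i _; rewrite FA IH.
Qed.

Variables (c : C) (m : nat).
Hypothesis FA : forall l x,
  F (A l.+1 x) = A l.+1 (F x) + (c * (l == m)%:R) *: x.

(** This is [F, S^q] = q c z^(m+1) S^(q-1) read off at z^n, for S the series with coefficients A; it
    rests on [F, S] = c z^(m+1) being a scalar. *)
Lemma series_pow_der q n x :
  F (series_pow A q n x) = series_pow A q n (F x)
    + (q%:R * c * (m < n)%:R) *: series_pow A q.-1 (n - m.+1) x.
Proof.
elim: q n => [|q IH] n /=.
  by rewrite !mul0r scale0r addr0; case: eqP => // _; rewrite lin0.
rewrite (lin_sum linF).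
under [LHS]eq_bigr => i _ do rewrite FA IH (linD (linA _)) (linZ (linA _)) addrAC -addrA.
rewrite big_split /=; congr (_ + _); rewrite big_split /= addrC.
have -> : \sum_(i < n) (c * (i == m :> nat)%:R) *: series_pow A q (n - i.+1) x =
    (c * (m < n)%:R) *: series_pow A q (n - m.+1) x.
  have [mn|mn] := ltnP m n; last first.
    rewrite mulr0 scale0r big1// => i _; rewrite [_ == _]ltn_eqF ?mulr0 ?scale0r//.
    exact: leq_trans mn.
  rewrite (bigD1 (Ordinal mn))//= eqxx big1 ?addr0// => i /negPf im.
  by rewrite -val_eqE /= in im; rewrite im mulr0 scale0r.
(* Of the factor q + 1, the summand 1 comes from the leading factor of the power and q from the
   induction hypothesis. *)
rewrite -[q.+1%:R]natr1 mulrDl mul1r mulrDl scalerDl; congr (_ + _).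
case: q {IH} => [|q] /=.
  by rewrite !mul0r scale0r big1// => i _; rewrite !mul0r scale0r.
have [mn|mn] := ltnP m n; last first.
  rewrite mulr0 scale0r big1// => i _.
  by rewrite (_ : (m < _)%N = false) ?mulr0 ?scale0r//; lia.
rewrite mulr1 scaler_sumr.
rewrite (big_ord_widen_cond n xpredT (fun i => (q.+1%:R * c) *:
  A i.+1 (series_pow A q (n - m.+1 - i.+1) x))) ?leq_subr//.
rewrite (bigID (fun i : 'I_n => i < n - m.+1)%N) /=.
rewrite [X in _ + X]big1 ?addr0 => [|i]; last first.
  by rewrite -leqNgt => im; rewrite (_ : (m < _)%N = false) ?mulr0 ?scale0r//; lia.
apply: eq_bigr => i im; rewrite (_ : (m < _)%N) ?mulr1; last by lia.
by congr (_ *: A _ (series_pow _ _ _ _)); lia.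
Qed.

(** This is [F, e^S] = c z^(m+1) e^S: the term q = 0 drops out, and (q+1)/(q+1)! = 1/q! shifts the
    series by one power. *)
Lemma series_exp_der n x :
  F (series_exp A n x) = series_exp A n (F x)
    + (c * (m < n)%:R) *: series_exp A (n - m.+1) x.
Proof.
rewrite {1 2}/series_exp (lin_sum linF).
under [LHS]eq_bigr => q _ do rewrite (linZ linF) series_pow_der scalerDr.
rewrite big_split /=; congr (_ + _).
rewrite big_ord_recl /= !mul0r scale0r scaler0 add0r.
have [mn|mn] := ltnP m n; last first.
  by rewrite mulr0 scale0r big1// => q _; rewrite mulr0 scale0r scaler0.
rewrite (@series_expE n.-1); last by lia.
rewrite prednK; last by lia.
rewrite scaler_sumr; apply: eq_bigr => q _; rewrite /bump /= add1n !scalerA.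
congr (_ *: _); rewrite factS natrM.
have : q.+1%:R != 0 :> C by rewrite pnatr_eq0.
have : q`!%:R != 0 :> C by rewrite pnatr_eq0 -lt0n fact_gt0.
by move: (q.+1%:R : C) (q`!%:R : C) => a b b0 a0; field; rewrite a0 b0.
Qed.

End Commutation.

End Series.

(** * Bosons *)

Lemma scaleC (C : comPzRingType) (T : lmodType C) (a b : C) (x : T) :
  a *: (b *: x) = b *: (a *: x).
Proof. by rewrite !scalerA mulrC. Qed.

Lemma scaleC3 (C : comPzRingType) (T : lmodType C) (a b c : C) (x : T) :
  a *: (b *: (c *: x)) = c *: (a *: (b *: x)).
Proof. by rewrite [b *: _]scaleC [LHS]scaleC. Qed.

Lemma scaleC4 (C : comPzRingType) (T : lmodType C) (a b c d : C) (x : T) :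
  a *: (b *: (c *: (d *: x))) = c *: (d *: (a *: (b *: x))).
Proof. by rewrite scaleC3 [in LHS](scaleC3 a b d). Qed.

Lemma scale_swap (C : comPzRingType) (T : lmodType C) (a b c d c' d' : C)
    (x y : T) :
  c *: (d *: x) = c' *: (d' *: y) ->
  a *: (c *: (b *: (d *: x))) = b *: (c' *: (a *: (d' *: y))).
Proof. by move=> xy; rewrite [LHS]scaleC3 xy [c' *: (a *: _)]scaleC. Qed.

Lemma scale_addr (C : comPzRingType) (T : lmodType C) (c d e : C) (x y z : T) :
  x = y + d *: z -> c * d = e -> c *: x = c *: y + e *: z.
Proof. by move=> -> <-; rewrite scalerDr scalerA. Qed.

Lemma scale_subr (C : comPzRingType) (T : lmodType C) (c d e : C) (x y z : T) :
  x = y + d *: z -> - (c * d) = e -> c *: y = c *: x + e *: z.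
Proof. by move=> -> <-; rewrite scalerDr scalerA scaleNr addrK. Qed.

Lemma cocycle0 (C : fieldType) (T : lmodType C) (c : C) (m n : int) (x y : T) :
  (m == 0) || (m + n != 0) -> y + (c * m%:~R * (m + n == 0)%:R) *: x = y.
Proof.
by case/orP => [/eqP->|/negPf->]; rewrite ?mulr0 ?mul0r scale0r addr0.
Qed.

Lemma shift_comm (C : pzRingType) (T : lmodType C) (D S : T -> T)
    (x x' y y' : T) (c : C) :
  S x = x' -> D x = y -> D x' = y' -> y' = S y + c *: x' ->
  D (S x) = S (D x) + c *: S x.
Proof. by move=> -> -> ->. Qed.

Lemma shift_sub (C : pzRingType) (T : lmodType C) (S : T -> T)
    (x y x' y' z : T) : linear S ->
  x' = S x + z -> y' = S y + z -> x' - y' = S (x - y).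
Proof.
by move=> lS -> ->; rewrite (linD lS) (linN lS) opprD addrACA subrr addr0.
Qed.

(** * The null difference of two currents *)

Section NullCurrent.
Context {C : comPzRingType} {T : lmodType C}.
Variables (F U : int -> T -> T) (e : int -> int -> C).
Hypothesis linF : forall n, linear (F n).
Hypothesis linU : forall n, linear (U n).
Hypothesis FU : forall m n x, F m (U n x) = U n (F m x).
Hypothesis FF : forall m n x, F m (F n x) = F n (F m x) - e m n *: x.
Hypothesis UU : forall m n x, U m (U n x) = U n (U m x) + e m n *: x.

Lemma null_comml m n x :
  F m (U n x - F n x) = U n (F m x) - F n (F m x) + e m n *: x.
Proof. by rewrite (linD (linF m)) (linN (linF m)) FU FF opprB addrA addrAC. Qed.

(** The cocycles e of U and -e of F cancel, whereas a mode of F alone still sees e, as in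
    [null_comml]. *)
Lemma null_comm m n x :
  U m (U n x - F n x) - F m (U n x - F n x) =
  U n (U m x - F m x) - F n (U m x - F m x).
Proof.
rewrite !(linD (linF _)) !(linD (linU _)) !(linN (linF _)) !(linN (linU _)).
rewrite !FU UU FF.
have key (a b c d y : T) : a + y - b - (c - (d - y)) = a - c - (b - d).
  rewrite !opprB [in LHS]addrACA [(a + y) + _]addrACA subrr addr0.
  by rewrite [RHS]addrACA [- b - c]addrC.
exact: key.
Qed.

End NullCurrent.

Section Bosons.
Context {C : numFieldType} (k : C).
Implicit Types (a : C) (f u : {mset nat}%mset) (x : bos C).

Local Notation bb a f u := (<< ((a, f, u) : bos_idx C) >> : bos C).

Lemma msetD1B (f : {mset nat}%mset) i j : i != j ->
  ((j +` f) `\ i = j +` (f `\ i))%mset.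
Proof.
move=> ij; apply/msetP => l; rewrite !(msetB1E, mset1DE).
by have [->|li] := eqVneq l i; rewrite ?(negPf ij) ?add0n// !subn0.
Qed.

Lemma msetBB (f : {mset nat}%mset) i j : ((f `\ i) `\ j = (f `\ j) `\ i)%mset.
Proof. by apply/msetP => l; rewrite !msetB1E subnAC. Qed.

Lemma mset_insert_remove (T : lmodType C) (G : {mset nat}%mset -> T) f i :
  (f i)%:R *: G (i +` (f `\ i))%mset = (f i)%:R *: G f.
Proof.
have [fi|fi] := posnP (f i); first by rewrite fi !scale0r.
by rewrite msetB1K// in_mset.
Qed.

(* The commutator of an annihilation and a creation operator. *)
Lemma mset_remove_insert (T : lmodType C) (G : {mset nat}%mset -> T) f i j :
  ((j +` f)%mset i)%:R *: G ((j +` f) `\ i)%mset =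
  (f i)%:R *: G (j +` (f `\ i))%mset + (i == j)%:R *: G f.
Proof.
rewrite mset1DE; have [<-|ij] := eqVneq i j.
  by rewrite msetD1K mset_insert_remove addnC natrD scalerDl.
by rewrite msetD1B// add0n scale0r addr0.
Qed.

Lemma mset_remove_remove (T : lmodType C) (G : {mset nat}%mset -> T) f i j :
  (f j)%:R *: (((f `\ j)%mset i)%:R *: G (f `\ j `\ i)%mset) =
  (f i)%:R *: (((f `\ i)%mset j)%:R *: G (f `\ i `\ j)%mset).
Proof.
rewrite !scalerA msetBB -!natrM !msetB1E [j == i]eq_sym.
have [->//|_] := eqVneq i j; by rewrite !subn0 mulnC.
Qed.

Lemma dF_linear n : linear (dF k n).
Proof. exact: linext_linear. Qed.

Lemma dU_linear n : linear (dU k n).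
Proof. exact: linext_linear. Qed.

Lemma dUF_linear n : linear (dUF k n).
Proof.
move=> a x y; rewrite /dUF dF_linear dU_linear scalerBr opprD.
by rewrite addrACA.
Qed.

Lemma bos_shift_linear a : linear (bos_shift a : bos C -> bos C).
Proof. exact: linext_linear. Qed.

Lemma dF_basis n a f u : dF k n (bb a f u) =
  match n with
  | Negz i => bb a (i +` f)%mset u
  | Posz 0 => (k * a / 2%:R) *: bb a f u
  | Posz i.+1 => (- (k / 2%:R) * i.+1%:R) *: ((f i)%:R *: bb a (f `\ i)%mset u)
  end.
Proof.
rewrite /dF linextE; case: n => [[|i]|i]; cbv beta iota; [reflexivity| |reflexivity].
by rewrite scalerA.
Qed.

Lemma dU_basis n a f u : dU k n (bb a f u) =
  match n with
  | Negz i => bb a f (i +` u)%mset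
  | Posz 0 => (k * a / 2%:R) *: bb a f u
  | Posz i.+1 => (k / 2%:R * i.+1%:R) *: ((u i)%:R *: bb a f (u `\ i)%mset)
  end.
Proof.
rewrite /dU linextE; case: n => [[|i]|i]; cbv beta iota; [reflexivity| |reflexivity].
by rewrite scalerA.
Qed.

Lemma bos_shift_basis b a f u : bos_shift b (bb a f u) = bb (a + b) f u.
Proof. by rewrite /bos_shift linextE. Qed.

Lemma bos_eq (T : lmodType C) (g h : bos C -> T) : linear g -> linear h ->
  (forall a f u, g (bb a f u) = h (bb a f u)) -> g =1 h.
Proof. by move=> lg lh gh; apply: malg_eq => // -[[a f] u]. Qed.

Lemma dF_dU m n x : dF k m (dU k n x) = dU k n (dF k m x).
Proof.
move: x; apply: bos_eq; try (apply: linear_comp; [exact: linext_linear..]).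
move=> a f u; rewrite dF_basis dU_basis.
case: m n => [[|i]|i] [[|j]|j]; rewrite ?(linZ (dF_linear _)) ?(linZ (dU_linear _)).
- by rewrite dF_basis dU_basis.
- by rewrite dF_basis dU_basis [LHS]scaleC3.
- by rewrite dF_basis dU_basis.
- by rewrite dF_basis dU_basis [RHS]scaleC3.
- rewrite dF_basis dU_basis; cbv beta iota; exact: scaleC4.
- by rewrite dF_basis dU_basis.
- by rewrite dF_basis dU_basis.
- by rewrite dF_basis dU_basis.
- by rewrite dF_basis dU_basis.
Qed.

Lemma dF_dF m n x : dF k m (dF k n x) = dF k n (dF k m x)
  + (- (k / 2%:R) * m%:~R * (m + n == 0)%:R) *: x.
Proof.
move: x; apply: bos_eq.
- exact: linear_comp (dF_linear m) (dF_linear n).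
- apply: linear_add; first exact: linear_comp (dF_linear n) (dF_linear m).
  exact: linear_scale.
move=> a f u; rewrite !dF_basis.
(* Index 0 is the zero mode, [Posz i.+1] annihilates and [Negz i] creates. The central term arises
   only from an annihilator and a creator of the same oscillator. *)
case: m n => [[|i]|i] [[|j]|j]; rewrite ?(linZ (dF_linear _)) ?dF_basis; cbv beta iota.
- by rewrite cocycle0; last by [].
- by rewrite cocycle0; [rewrite [LHS]scaleC3|].
- by rewrite cocycle0; last by [].
- by rewrite cocycle0; [rewrite [RHS]scaleC3|].
- rewrite cocycle0; last by [].
  apply: scale_swap.
  exact: (mset_remove_remove (fun g => bb a g u)).
- apply: scale_addr; first exact: (mset_remove_insert (fun g => bb a g u)).
  by congr (_ * _%:R); apply/eqP/eqP; lia.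
- by rewrite cocycle0; last by [].
- apply: scale_subr; first exact: (mset_remove_insert (fun g => bb a g u)).
  have -> : (Negz i + j.+1%:Z == 0) = (j == i) by apply/eqP/eqP; lia.
  case: eqP => [->|_]; last by rewrite !mulr0 oppr0.
  by rewrite !mulr1 NegzE mulrNz mulrN.
- by rewrite cocycle0; [rewrite msetDCA|].
Qed.

Lemma dU_dU m n x : dU k m (dU k n x) = dU k n (dU k m x)
  + (k / 2%:R * m%:~R * (m + n == 0)%:R) *: x.
Proof.
move: x; apply: bos_eq.
- exact: linear_comp (dU_linear m) (dU_linear n).
- apply: linear_add; first exact: linear_comp (dU_linear n) (dU_linear m).
  exact: linear_scale.
move=> a f u; rewrite !dU_basis.
case: m n => [[|i]|i] [[|j]|j]; rewrite ?(linZ (dU_linear _)) ?dU_basis; cbv beta iota.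
- by rewrite cocycle0; last by [].
- by rewrite cocycle0; [rewrite [LHS]scaleC3|].
- by rewrite cocycle0; last by [].
- by rewrite cocycle0; [rewrite [RHS]scaleC3|].
- rewrite cocycle0; last by [].
  apply: scale_swap.
  exact: (mset_remove_remove (fun g => bb a f g)).
- apply: scale_addr; first exact: (mset_remove_insert (fun g => bb a f g)).
  by congr (_ * _%:R); apply/eqP/eqP; lia.
- by rewrite cocycle0; last by [].
- apply: scale_subr; first exact: (mset_remove_insert (fun g => bb a f g)).
  have -> : (Negz i + j.+1%:Z == 0) = (j == i) by apply/eqP/eqP; lia.
  case: eqP => [->|_]; last by rewrite !mulr0 oppr0.
  by rewrite !mulr1 NegzE mulrNz mulrN.
- by rewrite cocycle0; [rewrite msetDCA|].
Qed.

Let e (m n : int) : C := k / 2%:R * m%:~R * (m + n == 0)%:R.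

Lemma dF_dFN m n x : dF k m (dF k n x) = dF k n (dF k m x) - e m n *: x.
Proof. by rewrite dF_dF -scaleNr -!mulNr. Qed.

Lemma dF_dUF m n x : dF k m (dUF k n x) = dUF k n (dF k m x) + e m n *: x.
Proof. exact: (null_comml dF_linear dF_dU dF_dFN m n x). Qed.

Lemma dUF_dUF m n x : dUF k m (dUF k n x) = dUF k n (dUF k m x).
Proof. exact: (null_comm dF_linear dU_linear dF_dU dF_dFN dU_dU m n x). Qed.

Lemma bos_shift_comm a b x : bos_shift a (bos_shift b x) = bos_shift b (bos_shift a x).
Proof.
move: x; apply: bos_eq; try (apply: linear_comp; [exact: linext_linear..]).
move=> c f u; transitivity (bb (c + b + a) f u).
  exact: etrans (congr1 _ (bos_shift_basis b c f u)) (bos_shift_basis a _ f u).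
rewrite (addrAC c b a); apply: esym.
exact: etrans (congr1 _ (bos_shift_basis a c f u)) (bos_shift_basis b _ f u).
Qed.

(** Only the zero mode, with eigenvalue k b / 2 at momentum b, notices a change of momentum. *)
Lemma dF_shift m a x : dF k m (bos_shift a x) = bos_shift a (dF k m x)
  + (k * a / 2%:R * (m == 0)%:R) *: bos_shift a x.
Proof.
move: x; apply: bos_eq.
- exact: linear_comp (dF_linear _) (bos_shift_linear _).
- apply: linear_add; first exact: linear_comp (bos_shift_linear _) (dF_linear _).
  exact: linear_scale_fun (bos_shift_linear _).
move=> b f u; have sh := bos_shift_basis a b.
apply: (shift_comm (sh f u) (dF_basis m b f u) (dF_basis m (b + a) f u)).
case: m => [[|i]|i]; cbv beta iota.
- rewrite (linZ (bos_shift_linear a)) sh -scalerDl mulr1.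
  by rewrite (mulrDr k b a) mulrDl.
- by rewrite !(linZ (bos_shift_linear a)) sh mulr0 scale0r addr0.
- by rewrite sh mulr0 scale0r addr0.
Qed.

Lemma dU_shift m a x : dU k m (bos_shift a x) = bos_shift a (dU k m x)
  + (k * a / 2%:R * (m == 0)%:R) *: bos_shift a x.
Proof.
move: x; apply: bos_eq.
- exact: linear_comp (dU_linear _) (bos_shift_linear _).
- apply: linear_add; first exact: linear_comp (bos_shift_linear _) (dU_linear _).
  exact: linear_scale_fun (bos_shift_linear _).
move=> b f u; have sh := bos_shift_basis a b.
apply: (shift_comm (sh f u) (dU_basis m b f u) (dU_basis m (b + a) f u)).
case: m => [[|i]|i]; cbv beta iota.
- rewrite (linZ (bos_shift_linear a)) sh -scalerDl mulr1.
  by rewrite (mulrDr k b a) mulrDl.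
- by rewrite !(linZ (bos_shift_linear a)) sh mulr0 scale0r addr0.
- by rewrite sh mulr0 scale0r addr0.
Qed.

(** The zero modes of [dU] and [dF] agree, so their momentum terms cancel in the difference. *)
Lemma dUF_shift m a x : dUF k m (bos_shift a x) = bos_shift a (dUF k m x).
Proof.
exact: (shift_sub (bos_shift_linear a) (dU_shift m a x) (dF_shift m a x)).
Qed.

End Bosons.

(** * The level grading of the Fock space *)

Section Levels.
Context {C : numFieldType} (k : C).
Implicit Types x : bos C.

Local Notation bb a f u := (<< ((a, f, u) : bos_idx C) >> : bos C).

(** The index i stands for the oscillator of mode -(i+1), whence its weight i + 1. *)
Definition mlevel (f : {mset nat}%mset) : nat := \sum_(i <- f) i.+1.

Lemma mlevel_remove (f : {mset nat}%mset) i : (0 < f i)%N ->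
  mlevel f = (i.+1 + mlevel (f `\ i)%mset)%N.
Proof.
move=> fi; rewrite /mlevel.
have -> : \sum_(l <- f) l.+1 = \sum_(l <- i :: (f `\ i)%mset) l.+1.
  apply: perm_big; apply/allP => l _ /=.
  rewrite !count_mem_mset msetB1E [l == i]eq_sym.
  by have [<-|_] := eqVneq i l; apply/eqP; lia.
by rewrite big_cons.
Qed.

Definition blevel (b : bos_idx C) : nat := (mlevel b.1.2 + mlevel b.2)%N.

(* x is a combination of basis vectors of level at most d, so x = 0 for d < 0. *)
Definition level_le (d : int) x := forall b, d < (blevel b)%:Z -> x@_b = 0.

Lemma level_leD d x y : level_le d x -> level_le d y -> level_le d (x + y).
Proof. by move=> dx dy b db; rewrite mcoeffD dx// dy// addr0. Qed.

Lemma level_leZ d a x : level_le d x -> level_le d (a *: x).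
Proof. by move=> dx b db; rewrite mcoeffZ dx// mulr0. Qed.

Lemma level_le_sum d (I : Type) (r : seq I) (P : pred I) (F : I -> bos C) :
  (forall i, P i -> level_le d (F i)) -> level_le d (\sum_(i <- r | P i) F i).
Proof.
move=> dF; elim/big_ind: _ => // [b _|x y]; first by rewrite mcoeff0.
exact: level_leD.
Qed.

Lemma level_leW d e x : level_le d x -> d <= e -> level_le e x.
Proof. by move=> dx de b eb; apply: dx; apply: le_lt_trans eb. Qed.

Lemma level_le_basis (b : bos_idx C) : level_le (blevel b) << b >>.
Proof. by move=> c bc; rewrite mcoeffU; case: eqP bc => // ->; rewrite ltxx. Qed.

Lemma level_le_eq0 d x : d < 0 -> level_le d x -> x = 0.
Proof. by move=> d0 dx; apply/malgP => b; rewrite mcoeff0 dx//; lia. Qed.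

Lemma level_le_exists x : exists d : nat, level_le d x.
Proof.
exists (\sum_(b <- msupp x) blevel b)%N; rewrite {2}[x]malg_basis.
rewrite [X in level_le _ X]big_seq; apply: level_le_sum => b bx; apply: level_leZ.
apply: level_leW (@level_le_basis b) _; rewrite lez_nat.
by rewrite (big_rem b)//= leq_addr.
Qed.

Lemma level_le_lin (g : bos C -> bos C) (m : nat) d x : linear g ->
  (forall b, level_le ((blevel b)%:Z - m%:Z) (g << b >>)) ->
  level_le d x -> level_le (d - m%:Z) (g x).
Proof.
move=> lg gb dx; rewrite [x]malg_basis (lin_sum lg) big_seq.
apply: level_le_sum => b; rewrite -mcoeff_neq0 (linZ lg) => xb.
apply: level_leZ; apply: level_leW (gb b) _; rewrite lerD2r.
by rewrite leNgt; apply: contra xb => /dx ->.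
Qed.

Lemma dUF_level (m : nat) d x : (0 < m)%N -> level_le d x ->
  level_le (d - m%:Z) (dUF k m x).
Proof.
case: m => // m _; apply: level_le_lin; first exact: dUF_linear.
move=> [[a f] u]; rewrite /dUF dF_basis dU_basis -scaleN1r.
apply: level_leD; apply: level_leZ; last apply: level_leZ.
- have [u0|u0] := posnP (u m); first by rewrite u0 scale0r => b _; rewrite mcoeff0.
  apply: level_leZ; apply: level_leW (@level_le_basis _) _.
  by rewrite /blevel /= (mlevel_remove u0); lia.
- have [f0|f0] := posnP (f m); first by rewrite f0 scale0r => b _; rewrite mcoeff0.
  apply: level_leZ; apply: level_leW (@level_le_basis _) _.
  by rewrite /blevel /= (mlevel_remove f0); lia.
Qed.

End Levels.

Arguments level_le_basis {C} b.

(** * Exponentials of a commuting current *)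

Section ExponentialFields.
Context {C : numFieldType} {T : lmodType C}.
Implicit Types (a b : C) (x : T) (n m : int).
Variables (W F : int -> T -> T) (S : C -> T -> T) (c : C).
Hypothesis linW : forall n, linear (W n).
Hypothesis linF : forall n, linear (F n).
Hypothesis linS : forall a, linear (S a).
Hypothesis WW : forall m n x, W m (W n x) = W n (W m x).
Hypothesis SS : forall a b x, S a (S b x) = S b (S a x).
Hypothesis WS : forall m a x, W m (S a x) = S a (W m x).
Hypothesis FW : forall m n x, F m (W n x) = W n (F m x)
  + (c * m%:~R * (m + n == 0)%:R) *: x.
Hypothesis FS : forall m a x, F m (S a x) = S a (F m x)
  + (c * a * (m == 0)%:R) *: S a x.

Definition exp_up a (i : nat) : T -> T :=
  series_exp (fun (m : nat) y => (a / m%:R) *: W (- m%:Z) y) i.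

Definition exp_dn a (i : nat) : T -> T :=
  series_exp (fun (m : nat) y => (- a / m%:R) *: W m%:Z y) i.

(* The two exponential factors as fields \sum_n A n z^(-n-1). *)
Definition exp_P a n : T -> T :=
  if n is Negz i then exp_up a i else fun _ => 0.

Definition exp_N a n : T -> T :=
  if n + 1 is Posz i then exp_dn a i else fun _ => 0.

Hypothesis nilW : forall a x, exists N : nat, forall i : nat,
  (N < i)%N -> exp_dn a i x = 0.

Let up_lin a (m : nat) : linear (fun y => (a / m%:R) *: W (- m%:Z) y).
Proof. exact: linear_scale_fun. Qed.

Let dn_lin a (m : nat) : linear (fun y => (- a / m%:R) *: W m%:Z y).
Proof. exact: linear_scale_fun. Qed.

Lemma exp_P_linear a n : linear (exp_P a n).
Proof.
case: n => n; first exact: linear_zero.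
exact: series_exp_linear (up_lin a) _.
Qed.

Lemma exp_N_linear a n : linear (exp_N a n).
Proof.
rewrite /exp_N; case: (n + 1) => i; last exact: linear_zero.
exact: series_exp_linear (dn_lin a) _.
Qed.

Lemma isfield_exp_P a : isfield (exp_P a).
Proof. by split=> [n|x]; [exact: exp_P_linear | exists 0 => -[]]. Qed.

Lemma isfield_exp_N a : isfield (exp_N a).
Proof.
split=> [n|x]; first exact: exp_N_linear.
have [N xN] := nilW a x; exists N%:Z => n Nn; rewrite /exp_N.
have -> : n + 1 = (absz (n + 1))%:Z by lia.
by apply: xN; lia.
Qed.

Section Commutant.
Variables (G : T -> T) (linG : linear G).

Lemma exp_P_comm a n x : (forall m x, m < 0 -> G (W m x) = W m (G x)) ->
  G (exp_P a n x) = exp_P a n (G x).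
Proof.
move=> GW; case: n => n /=; first by rewrite lin0.
by apply: series_exp_comm => // m y; rewrite (linZ linG) GW.
Qed.

Lemma exp_N_comm a n x : (forall m x, 0 < m -> G (W m x) = W m (G x)) ->
  G (exp_N a n x) = exp_N a n (G x).
Proof.
move=> GW; rewrite /exp_N; case: (n + 1) => i; last by rewrite lin0.
by apply: series_exp_comm => // m y; rewrite (linZ linG) GW.
Qed.

End Commutant.

Lemma exp_PW a m n x : W m (exp_P a n x) = exp_P a n (W m x).
Proof. by apply: exp_P_comm => // l y _; rewrite WW. Qed.

Lemma exp_PN a b m n x : exp_P a m (exp_N b n x) = exp_N b n (exp_P a m x).
Proof. by apply: exp_N_comm => [|l y _]; [exact: exp_P_linear | rewrite exp_PW]. Qed.

(** The two exponential factors commute by [exp_PN], so [nop] is just their product as series.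
    Writing it as [nop] makes the results on boundedness, signs and derivations available. *)
Definition exp_field a n x : T := S a (nop (exp_P a) (exp_N a) n x).

Let nopPN a n x := nop (exp_P a) (exp_N a) n x.

Let isfield_nopPN a : isfield (nopPN a).
Proof. exact: isfield_nop (isfield_exp_P a) (isfield_exp_N a). Qed.

Lemma isfield_exp a : isfield (exp_field a).
Proof.
have [lPN bPN] := isfield_nopPN a; split=> [n|x].
  exact: linear_comp (linS a) (lPN n).
by have [N xN] := bPN x; exists N => n /xN; rewrite /exp_field /nopPN => ->; apply: lin0.
Qed.

Section NopCommutant.
Variables (G : T -> T) (linG : linear G).

Lemma nop_exp_comm a n x : (forall m x, m != 0 -> G (W m x) = W m (G x)) ->
  G (nopPN a n x) = nopPN a n (G x).
Proof.
move=> GW; rewrite /nopPN.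
rewrite (nop_sign (isfield_exp_P a) (isfield_exp_N a) n x (s := 1) (t := 1))//.
- by rewrite mulr1 scale1r.
- by move=> i y; rewrite scale1r; apply: exp_P_comm => // m z m0; rewrite GW//; lia.
- by move=> i y; rewrite scale1r; apply: exp_N_comm => // m z m0; rewrite GW//; lia.
Qed.

End NopCommutant.

Lemma exp_field_W a m n x : W m (exp_field a n x) = exp_field a n (W m x).
Proof. by rewrite /exp_field WS (nop_exp_comm (linW m))// => l y _; rewrite WW. Qed.

Lemma exp_field_S a b n x : S b (exp_field a n x) = exp_field a n (S b x).
Proof. by rewrite /exp_field SS (nop_exp_comm (linS b))// => l y _; rewrite WS. Qed.

(** The field of momentum b is built from modes of W and a shift, and the field of momentum a
    commutes with all of these because W commutes with itself. *)
Lemma exp_field_comm a b m n x :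
  exp_field a m (exp_field b n x) = exp_field b n (exp_field a m x).
Proof.
rewrite {2}/exp_field -exp_field_S {2}/exp_field; congr (S b _).
have [lin_a _] := isfield_exp a.
apply: (nop_exp_comm (lin_a m)) => l y _; exact/esym/exp_field_W.
Qed.

(** The denominator in the exponent cancels the mode number in the commutator with F, which leaves
    the scalar c a whatever m is. In [exp_N_der] the sign of - a moreover cancels that of the
    negative mode. *)
Lemma exp_P_der a m i x : 0 < m ->
  F m (exp_P a i x) = exp_P a i (F m x) + (c * a) *: exp_P a (i + m) x.
Proof.
case: m => [[|m]|m]// _; case: i => i.
  by rewrite /= lin0// scaler0 addr0.
rewrite {1 2}/exp_P /exp_up.
rewrite (series_exp_der (up_lin a) (linF m.+1) (c := c * a) (m := m)).
  congr (_ + _); have [mi|mi] := ltnP m i.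
    rewrite mulr1 (_ : Negz i + m.+1%:Z = Negz (i - m.+1)); last by lia.
    by [].
  rewrite mulr0 scale0r (_ : Negz i + m.+1%:Z = (m - i)%N%:Z); last by lia.
  by rewrite scaler0.
move=> l y; rewrite (linZ (linF _)) FW scalerDr scalerA; congr (_ + _ *: _).
have -> : (m.+1%:Z - l.+1%:Z == 0) = (l == m) by apply/eqP/eqP; lia.
case: eqP => [->|_]; last by rewrite !mulr0.
rewrite !mulr1 -[m.+1%:~R]/(m.+1%:R : C).
have : m.+1%:R != 0 :> C by rewrite pnatr_eq0.
by move: (m.+1%:R : C) => d d0; field.
Qed.

Lemma exp_N_der a m i x : m < 0 ->
  F m (exp_N a i x) = exp_N a i (F m x) + (c * a) *: exp_N a (i + m) x.
Proof.
case: m => m // _; rewrite {1 2}/exp_N.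
case e: (i + 1) => [j|j]; last first.
  rewrite lin0// add0r /exp_N (_ : i + Negz m + 1 = Negz (m + j).+1); last by lia.
  by rewrite scaler0.
rewrite /exp_dn (series_exp_der (dn_lin a) (linF (Negz m)) (c := c * a) (m := m)).
  congr (_ + _); have [mi|mi] := ltnP m j.
    rewrite mulr1 /exp_N (_ : i + Negz m + 1 = (j - m.+1)%N); last by lia.
    by [].
  rewrite mulr0 scale0r /exp_N (_ : i + Negz m + 1 = Negz (m - j)); last by lia.
  by rewrite scaler0.
move=> l y; rewrite (linZ (linF _)) FW scalerDr scalerA; congr (_ + _ *: _).
have -> : (Negz m + l.+1%:Z == 0) = (l == m) by apply/eqP/eqP; lia.
case: eqP => [->|_]; last by rewrite !mulr0.
rewrite !mulr1 NegzE mulrNz -[m.+1%:~R]/(m.+1%:R : C).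
have : m.+1%:R != 0 :> C by rewrite pnatr_eq0.
by move: (m.+1%:R : C) => d d0; field.
Qed.

(** A positive mode of F meets only the creation half, a negative mode only the annihilation half,
    and the zero mode only the shift; all three give the same scalar c a. *)
Lemma exp_field_der a m n x :
  F m (exp_field a n x) = exp_field a n (F m x) + (c * a) *: exp_field a (n + m) x.
Proof.
have fP := isfield_exp_P a; have fN := isfield_exp_N a.
rewrite /exp_field FS -[(c * a) *: _](linZ (linS a)).
have [m0|m0|->] := ltgtP m 0.
- rewrite mulr0 scale0r addr0 -(linD (linS a)); congr (S a _).
  rewrite (nop_derr fP fN (B' := fun i y => (c * a) *: exp_N a (i + m) y)) //.
  + congr (_ + _); rewrite nopE// zsumZ; last exact: fsupp_nopt.
    apply: eq_zsum => i; rewrite /nopt; case: ifP => _; last first.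
      by congr (_ *: exp_N _ _ _); lia.
    rewrite (linZ (exp_P_linear _ _)); congr (_ *: exp_P _ _ (exp_N _ _ _)); lia.
  + by apply: isfield_scale; apply: isfield_shift.
  + move=> i y; apply: exp_P_comm => // l z l0; rewrite FW.
    by rewrite (_ : (m + l == 0) = false) ?mulr0 ?scale0r ?addr0//; lia.
  + by move=> i y; apply: exp_N_der.
- rewrite mulr0 scale0r addr0 -(linD (linS a)); congr (S a _).
  rewrite (nop_derl fP fN (A' := fun i y => (c * a) *: exp_P a (i + m) y)) //.
  + congr (_ + _); rewrite -nop_shiftl//; last by move=> i j y; apply: exp_PN.
    rewrite zsumZ; last first.
      exact: (fsupp_comm (isfield_shift m fP) fN (fun _ _ _ => exp_PN _ _ _ _ _)).
    apply: eq_zsum => i; rewrite /nopt; case: ifP => _ //.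
    by rewrite (linZ (exp_N_linear _ _)) exp_PN.
  + by apply: isfield_scale; apply: isfield_shift.
  + by move=> i y; apply: exp_P_der.
  + move=> i y; apply: exp_N_comm => // l z l0; rewrite FW.
    by rewrite (_ : (m + l == 0) = false) ?mulr0 ?scale0r ?addr0//; lia.
- rewrite addr0 mulr1 (linZ (linS a)); congr (S a _ + _).
  apply: (nop_exp_comm (linF 0)) => l y l0; rewrite FW.
  by rewrite mulr0 mul0r scale0r addr0.
Qed.

(** The annihilation half reduces to its constant term, which leaves nonnegative powers of z only,
    with the shift as the coefficient of z^0. *)
Lemma exp_field_vac a n x : (forall m, 0 < m -> W m x = 0) -> 0 <= n + 1 ->
  exp_field a n x = if n == -1 then S a x else 0.
Proof.
move=> Wx n0; rewrite /exp_field nopE; [|exact: isfield_exp_P|exact: isfield_exp_N].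
have Nx i : exp_N a i x = if i == -1 then x else 0.
  rewrite /exp_N; case e: (i + 1) => [j|j]; last by case: eqP => // ii; lia.
  have [j0|j0] := posnP j.
    by rewrite j0 /exp_dn series_exp0 (_ : i = -1) ?eqxx//; lia.
  rewrite (_ : (i == -1) = false); last by lia.
  by apply: series_exp_vac (dn_lin a) _ _ _ _ => // m; rewrite Wx ?scaler0.
rewrite (@zsum_single _ _ n) => [|i ni]; rewrite /nopt.
  rewrite (_ : n - 1 - n = -1) ?Nx ?eqxx; last by lia.
  have [n1|n1] := ltP n 0; last first.
    rewrite (_ : exp_P a n x = 0); last by case: (n) n1.
    by rewrite (lin0 (exp_N_linear _ _)) (lin0 (linS _)); case: eqP => // ?; lia.
  have -> : n = -1 by lia.
  by rewrite /= /exp_up series_exp0.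
case: ifP => i0; last first.
  by case: i ni i0 => // i _ _; apply: (lin0 (exp_N_linear _ _)).
rewrite Nx (_ : (_ == -1) = false) ?(lin0 (exp_P_linear _ _))//; lia.
Qed.

End ExponentialFields.

Lemma scale_eq0 (C : pzRingType) (T : lmodType C) (c d e : C) (x y : T) :
  d = 0 -> e = 0 -> c *: (d *: x) = e *: y.
Proof. by move=> -> ->; rewrite !scale0r scaler0. Qed.

Lemma der_transport (C : pzRingType) (T : lmodType C) (D : T -> T)
    (v v' : int -> T -> T) (c : C) m n x : (forall n x, v n x = v' n x) ->
  D (v' n x) = v' n (D x) + c *: v' m x -> D (v n x) = v n (D x) + c *: v m x.
Proof. by move=> vv; rewrite !vv. Qed.

Lemma comm_transport (T : Type) (u u' v v' : int -> T -> T) m n x :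
  (forall n x, u n x = u' n x) -> (forall n x, v n x = v' n x) ->
  u' m (v' n x) = v' n (u' m x) -> u m (v n x) = v n (u m x).
Proof. by move=> uu vv; rewrite !uu !vv. Qed.

(** * Vertex operators on the Fock space *)

Section Vertex.
Context {C : numFieldType} (k : C).
Implicit Types (a b : C) (x : bos C) (n m : int).

Lemma isfield_dF : isfield (dF k).
Proof.
split=> [n|x]; first exact: dF_linear.
have [d dx] := level_le_exists x; exists (d%:Z + 1) => n.
case: n => [[|m]|m] dm; do 1?[lia].
apply: (@level_le_eq0 _ (d%:Z - m.+1%:Z)); first by lia.
move: dx; apply: level_le_lin; first exact: dF_linear.
move=> [[a f] u]; rewrite dF_basis; apply: level_leZ.
have [f0|f0] := posnP (f m); first by rewrite f0 scale0r => b _; rewrite mcoeff0.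
apply: level_leZ; apply: level_leW (level_le_basis _) _.
by rewrite /blevel /= (mlevel_remove f0); lia.
Qed.

Lemma exp_dn_level a i d x : level_le d x ->
  level_le (d - i%:Z) (exp_dn (dUF k) a i x).
Proof.
move=> dx; apply: level_le_sum => q _; apply: level_leZ.
move: {q}(q : nat) => q; elim: q i => [|q IH] i /=.
  by case: eqP => [->|_ b _]; rewrite ?subr0// mcoeff0.
apply: level_le_sum => l _; apply: level_leZ.
have H := @dUF_level _ k l.+1 _ _ isT (IH (i - l.+1)%N).
apply: level_leW H _.
by case: l => l /= li; lia.
Qed.

Lemma exp_dn_nil a x : exists N : nat, forall i : nat,
  (N < i)%N -> exp_dn (dUF k) a i x = 0.
Proof.
have [d dx] := level_le_exists x; exists d => i di.
by apply: (level_le_eq0 _ (@exp_dn_level a i d x dx)); lia.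
Qed.

(** The defining sum runs over pairs of degrees, the other one over a single mode: the pair (i, j)
    corresponds to the mode [Negz i], and j is then determined by n. *)
Lemma vertexE a n x :
  vertex k a n x = exp_field (dUF k) (@bos_shift C) a n x.
Proof.
have fP := isfield_exp_P (dUF_linear k) a.
have fN := isfield_exp_N (dUF_linear k) exp_dn_nil a.
rewrite /exp_field (nopE fP fN) (zsum_lin (bos_shift_linear a) (fsupp_nopt fP fN n x)).
(* Nonnegative modes of the creation half vanish, and for i > n the annihilation half would have
   negative degree. *)
rewrite /zsum -(fsbig_widen [set i : int | i < 0 /\ i <= n]%classic) //; last first.
  move=> i [_ ni]; apply: etrans (lin0 (bos_shift_linear a)); congr (bos_shift a _).
  rewrite /nopt; case: i ni => i ni; cbv beta iota.
    exact: lin0 (exp_N_linear (dUF_linear k) _ _).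
  apply: etrans (lin0 (exp_P_linear (dUF_linear k) a (Negz i))).
  congr (exp_P _ _ _ _); rewrite /exp_N.
  have ni' : n < Negz i by rewrite ltNge; apply/negP => ?; apply: ni.
  by have -> : n - 1 - Negz i + 1 = Negz (absz (n - Negz i)).-1 by lia.
rewrite (reindex_fsbig (fun i : nat * nat => Negz i.1)
  [set i : nat * nat | i.1%:Z - i.2%:Z = - n - 1]%classic); last first.
  split=> [[i j] /= ij|[i j] [i' j']|i /= [i0 ni]].
  - by lia.
  - by rewrite !inE /= => ij ij' ii'; congr (_, _); lia.
  - exists ((absz i).-1, absz (n - i)) => /=; lia.
apply: eq_fsbigr => -[i j]; rewrite inE /= => ij.
have E : n - 1 - Negz i + 1 = j by lia.
have -> : nopt (exp_P (dUF k) a) (exp_N (dUF k) a) n x (Negz i) =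
    exp_up (dUF k) a i (exp_dn (dUF k) a j x) by rewrite /nopt /= /exp_N E.
reflexivity.
Qed.

Let linW := @dUF_linear C k.
Let linS := @bos_shift_linear C.
Let WW := @dUF_dUF C k.
Let SS := @bos_shift_comm C.
Let WS := @dUF_shift C k.

Lemma isfield_vertex a : isfield (vertex k a).
Proof.
have [l b] := isfield_exp linW linS exp_dn_nil a.
split=> [n c x y|x]; first by rewrite !vertexE; apply: l.
by have [N xN] := b x; exists N => n /xN; rewrite vertexE.
Qed.

Lemma vertex_comm a b m n x :
  vertex k a m (vertex k b n x) = vertex k b n (vertex k a m x).
Proof.
apply: (comm_transport (vertexE a) (vertexE b)).
exact: (exp_field_comm linW linS WW SS WS exp_dn_nil a b m n x).
Qed.

Lemma dF_vertex a m n x : dF k m (vertex k a n x) =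
  vertex k a n (dF k m x) + (k / 2%:R * a) *: vertex k a (n + m) x.
Proof.
have FS m' a' x' : dF k m' (bos_shift a' x') = bos_shift a' (dF k m' x')
    + (k / 2%:R * a' * (m' == 0)%:R) *: bos_shift a' x'.
  have -> : k / 2%:R * a' = k * a' / 2%:R by rewrite mulrAC.
  exact: dF_shift.
apply: (der_transport (vertexE a)).
exact: (exp_field_der linW (dF_linear k) linS WW (dF_dUF k) FS exp_dn_nil a m n x).
Qed.

Lemma dF_vac a n : 0 <= n ->
  dF k n (bos_vac a) = (k * a / 2%:R * (n == 0)%:R) *: bos_vac a.
Proof.
case: n => [[|i]|i]// _; apply: etrans (dF_basis k _ a mset0 mset0) _; cbv beta iota.
  by rewrite mulr1.
by apply: scale_eq0; rewrite ?mset0E ?mulr0.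
Qed.

Lemma dUF_vac a n : 0 < n -> dUF k n (bos_vac a) = 0.
Proof.
case: n => [[|i]|i]// _.
rewrite -[RHS](subrr 0); congr (_ - _).
  apply: etrans (dU_basis k _ a mset0 mset0) _; cbv beta iota.
  by rewrite -[RHS](scale0r (bos_vac a)); apply: scale_eq0; rewrite ?mset0E.
apply: etrans (dF_basis k _ a mset0 mset0) _; cbv beta iota.
by rewrite -[RHS](scale0r (bos_vac a)); apply: scale_eq0; rewrite ?mset0E.
Qed.

Lemma vertex_vac a b n : 0 <= n + 1 ->
  vertex k a n (bos_vac b) = if n == -1 then bos_vac (b + a) else 0.
Proof.
move=> n0; have := exp_field_vac linW linS exp_dn_nil a (dUF_vac b) n0.
have -> : bos_shift a (bos_vac b) = bos_vac (b + a) :=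
  bos_shift_basis a b mset0 mset0.
exact: etrans (vertexE a n _).
Qed.

End Vertex.

(** * Fermions *)

Section BoundedSums.
Context {C : fieldType} {T : lmodType C} (A : int -> T -> T).
Hypothesis linA : forall n, linear (A n).

Lemma bounded_sum (I : Type) (r : seq I) (f : I -> T) :
  (forall i, exists N, forall n, N <= n -> A n (f i) = 0) ->
  exists N, forall n, N <= n -> A n (\sum_(i <- r) f i) = 0.
Proof.
move=> fN; elim: r => [|i r [N IH]].
  by exists 0 => n _; rewrite big_nil lin0.
have [M iM] := fN i; exists (Num.max M N) => n; rewrite ge_max => /andP[Mn Nn].
by rewrite big_cons (linD (linA n)) iM// IH// addr0.
Qed.

End BoundedSums.

Section Fermions.
Context {C : numFieldType}.
Implicit Types (x : fer_idx) (A B : {fset nat}) (a b : nat).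

Lemma nbelow_add A a b : b \notin A ->
  nbelow (b |` A)%fset a = ((b < a) + nbelow A a)%N.
Proof.
move=> bA; rewrite /nbelow -[RHS]/(count _ (b :: A)); apply/permP.
apply: uniq_perm; rewrite /= ?fset_uniq ?bA//= => c.
by rewrite in_fset1U inE.
Qed.

Lemma nbelow_rem A a b : b \in A ->
  nbelow A a = ((b < a) + nbelow (A `\ b)%fset a)%N.
Proof. by move=> bA; rewrite -nbelow_add ?fsetD1K// !inE eqxx. Qed.

(* The basis vector x is sent to the basis vector h x with the sign of s x when
   g x holds, and to 0 otherwise. *)
Definition signed_map (g : pred fer_idx) (s : fer_idx -> nat)
    (h : fer_idx -> fer_idx) x : fer C :=
  if g x then (-1) ^+ s x *: << h x >> else 0.

(** Anticommutation becomes a combinatorial check: both orders are nonzero on the same basis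
    vectors, lead to the same basis vector, and have sign exponents of opposite parity. *)
Lemma signed_map_anticomm g1 s1 h1 g2 s2 h2 :
  (forall x, (g2 x && g1 (h2 x)) = (g1 x && g2 (h1 x))) ->
  (forall x, g2 x && g1 (h2 x) -> h1 (h2 x) = h2 (h1 x) /\
     odd (s2 x + s1 (h2 x)) = ~~ odd (s1 x + s2 (h1 x))) ->
  forall y : fer C, linext (signed_map g1 s1 h1) (linext (signed_map g2 s2 h2) y) =
    - linext (signed_map g2 s2 h2) (linext (signed_map g1 s1 h1) y).
Proof.
move=> gg hs y; have l1 := linext_linear (signed_map g1 s1 h1).
have l2 := linext_linear (signed_map g2 s2 h2).
move: y; apply: malg_eq; first exact: linear_comp l1 l2.
  by move=> a u v /=; rewrite l1 l2 opprD scalerN.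
move=> x; rewrite !linextE.
have E g s h g' s' h' : linext (signed_map g' s' h') (signed_map g s h x) =
    if g x && g' (h x) then (-1) ^+ (s x + s' (h x)) *: << h' (h x) >> else 0.
  rewrite {2}/signed_map; case: (g x) => /=; last by rewrite (lin0 (linext_linear _)).
  rewrite (linZ (linext_linear _)) linextE /signed_map.
  by case: ifP => _; rewrite ?scaler0// scalerA exprD.
rewrite !E gg; case: ifP => [gx|_]; last by rewrite oppr0.
have [-> e] := hs x (etrans (gg x) gx).
rewrite -[in LHS]signr_odd -[in RHS]signr_odd e.
by rewrite signrN scaleNr.
Qed.

(** In these names [p] and [b] refer to the psi and psibar slots of a basis vector, [c] and [d] to
    creation and destruction. The operators [bc] and [bd] have to cross all psi factors, hence the
    cardinal in their exponents. *)
Let pc a := signed_map (fun x => a \notin x.1) (fun x => nbelow x.1 a)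
  (fun x => (a |` x.1, x.2)%fset).
Let pd a := signed_map (fun x => a \in x.1) (fun x => nbelow x.1 a)
  (fun x => (x.1 `\ a, x.2)%fset).
Let bc b := signed_map (fun x => b \notin x.2)
  (fun x => #|` x.1| + nbelow x.2 b)%N (fun x => (x.1, b |` x.2)%fset).
Let bd b := signed_map (fun x => b \in x.2)
  (fun x => #|` x.1| + nbelow x.2 b)%N (fun x => (x.1, x.2 `\ b)%fset).

Lemma psiE n : @psi C n = linext
  (match n with Posz i.+1 => bd i | Posz 0 => pc 0 | Negz i => pc i.+1 end).
Proof.
rewrite /psi; congr linext; apply/funext => x; case: n => [[|i]|i] //.
- by rewrite /psi_create /pc /signed_map if_neg.
- by rewrite /psi_create /pc /signed_map if_neg.
Qed.

Lemma psibarE n : @psibar C n = linext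
  (match n with Posz i => pd i | Negz i => bc i end).
Proof.
rewrite /psibar; congr linext; apply/funext => x; case: n => i //.
by rewrite /psibar_create /bc /signed_map if_neg.
Qed.

Let in2 := (in_fset1U, in_fsetD1).

(** Of two distinct indices exactly one lies below the other, so exactly one of the two orders of
    insertion picks up an additional sign. *)
Let insert_anticomm A a b : b \notin A -> a \notin (b |` A)%fset ->
  (a |` (b |` A) = b |` (a |` A))%fset /\
  odd (nbelow A b + nbelow (b |` A)%fset a) =
    ~~ odd (nbelow A a + nbelow (a |` A)%fset b).
Proof.
rewrite in_fset1U negb_or => bA /andP[ab aA]; split; first exact: fsetUCA.
by rewrite !nbelow_add// !oddD; case: ltngtP ab => //= _ _; do 2!case: odd.
Qed.

Let remove_anticomm A a b : b \in A -> a \in (A `\ b)%fset ->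
  (A `\ b `\ a = A `\ a `\ b)%fset /\
  odd (nbelow A b + nbelow (A `\ b)%fset a) =
    ~~ odd (nbelow A a + nbelow (A `\ a)%fset b).
Proof.
rewrite in_fsetD1 => bA /andP[ab aA]; split; first by rewrite !fsetDDl fsetUC.
rewrite (nbelow_rem b aA) (nbelow_rem a bA) !oddD.
by case: ltngtP ab => //= _ _; do 2!case: odd.
Qed.

Let create1_create1 a b y :
  linext (pc a) (linext (pc b) y) = - linext (pc b) (linext (pc a) y).
Proof.
apply: signed_map_anticomm => -[A B] /=.
  by rewrite !in2 !negb_or eq_sym andbCA andbA andbC.
by case/andP => bA aA; have [-> ->] := insert_anticomm bA aA.
Qed.

Let destroy1_destroy1 a b y :
  linext (pd a) (linext (pd b) y) = - linext (pd b) (linext (pd a) y).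
Proof.
apply: signed_map_anticomm => -[A B] /=.
  by rewrite !in2 eq_sym andbCA andbA andbC.
by case/andP => bA aA; have [-> ->] := remove_anticomm bA aA.
Qed.

Let create2_create2 a b y :
  linext (bc a) (linext (bc b) y) = - linext (bc b) (linext (bc a) y).
Proof.
apply: signed_map_anticomm => -[A B] /=.
  by rewrite !in2 !negb_or eq_sym andbCA andbA andbC.
case/andP => bA aA; have [-> e] := insert_anticomm bA aA; split=> //.
by rewrite addnACA oddD e addnACA [in RHS]oddD addbN.
Qed.

Let destroy2_destroy2 a b y :
  linext (bd a) (linext (bd b) y) = - linext (bd b) (linext (bd a) y).
Proof.
apply: signed_map_anticomm => -[A B] /=.
  by rewrite !in2 eq_sym andbCA andbA andbC.
case/andP => bA aA; have [-> e] := remove_anticomm bA aA; split=> //.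
by rewrite addnACA oddD e addnACA [in RHS]oddD addbN.
Qed.

(** The slots are different; the sign comes from the number of psi factors, which [pc] changes by
    one. *)
Let create1_destroy2 a b y :
  linext (pc a) (linext (bd b) y) = - linext (bd b) (linext (pc a) y).
Proof.
apply: signed_map_anticomm => -[A B] /=; first by rewrite andbC.
case/andP => bB aA; split=> //; rewrite cardfsU1 aA !oddD /=.
by do 3!case: odd.
Qed.

Let destroy1_create2 a b y :
  linext (pd a) (linext (bc b) y) = - linext (bc b) (linext (pd a) y).
Proof.
apply: signed_map_anticomm => -[A B] /=; first by rewrite andbC.
case/andP => bB aA; split=> //; rewrite [in LHS](cardfsD1 a) aA !oddD /=.
by do 3!case: odd.
Qed.

Lemma psi_anticomm m n y : @psi C m (psi n y) = - psi n (psi m y).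
Proof.
rewrite !psiE; case: m n => [[|i]|i] [[|j]|j];
  do 1?[exact: create1_create1 | exact: destroy2_destroy2 | exact: create1_destroy2];
  by rewrite create1_destroy2 opprK.
Qed.

Lemma psibar_anticomm m n y : @psibar C m (psibar n y) = - psibar n (psibar m y).
Proof.
rewrite !psibarE; case: m n => [i|i] [j|j];
  do 1?[exact: create2_create2 | exact: destroy1_destroy1 | exact: destroy1_create2].
by rewrite destroy1_create2 opprK.
Qed.

Lemma psi_linear n : linear (@psi C n).
Proof. exact: linext_linear. Qed.

Lemma psibar_linear n : linear (@psibar C n).
Proof. exact: linext_linear. Qed.

Lemma fset_bound A : exists N, forall a, (N < a)%N -> a \notin A.
Proof.
exists (\sum_(a <- A) a)%N => a; apply: contraTN => aA.
by rewrite -leqNgt (big_rem a)//= leq_addr.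
Qed.

Lemma isfield_psi : isfield (fun n => @psi C (n + 1)).
Proof.
split=> [n|y]; first exact: psi_linear.
rewrite [y]malg_basis; apply: (bounded_sum (fun n => psi_linear (n + 1))) => -[A B].
have [N BN] := fset_bound B; exists (N%:Z + 1) => n Nn.
rewrite (linZ (psi_linear _)) psiE linextE.
have -> : n + 1 = (absz n).+1%:Z by lia.
by rewrite /bd /signed_map /= (negPf (BN _ _)) ?scaler0//; lia.
Qed.

Lemma isfield_psibar : isfield (@psibar C).
Proof.
split=> [n|y]; first exact: psibar_linear.
rewrite [y]malg_basis; apply: (bounded_sum psibar_linear) => -[A B].
have [N AN] := fset_bound A; exists (N%:Z + 1) => n Nn.
rewrite (linZ (psibar_linear _)) psibarE linextE.
have -> : n = (absz n)%:Z by lia.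
by rewrite /pd /signed_map /= (negPf (AN _ _)) ?scaler0//; lia.
Qed.

Lemma psi_vac n : 0 < n -> psi n (fer_vac C) = 0.
Proof. by case: n => [[|n]|n]// _; rewrite psiE linextE. Qed.

Lemma psibar_vac n : 0 <= n -> psibar n (fer_vac C) = 0.
Proof. by case: n => // n _; rewrite psibarE linextE. Qed.

End Fermions.

(** * The tensor product *)

Section Tensor.
Context {C : numFieldType} {V : lmodType C}.
Implicit Types (v : V) (b : bos C) (y : fer C) (w : tspace V).

Local Notation K := (bos_idx C * fer_idx)%type.

Lemma big_delta (I : choiceType) (D : {fset I}) (F : I -> V) i :
  (i \notin D -> F i = 0) -> \sum_(j <- D) F j *+ (j == i) = F i.
Proof.
move=> Fi; have [iD|iD] := boolP (i \in D); last first.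
  rewrite Fi// big_seq big1// => j jD; case: eqP => // ji.
  by rewrite ji (negPf iD) in jD.
rewrite (big_fsetD1 i iD)/= eqxx big_seq big1 ?addr0// => j.
by rewrite !inE => /andP[/negPf-> _].
Qed.

Lemma tens_coef v b y i l : (tens v b y)@_(i, l) = (b@_i * y@_l) *: v.
Proof.
rewrite /tens raddf_sum /=.
rewrite -(@big_delta _ (msupp b) (fun i' => (b@_i' * y@_l) *: v) i); last first.
  by move=> /mcoeff_outdom ->; rewrite mul0r scale0r.
apply: eq_bigr => i' _; rewrite raddf_sum /=.
rewrite -(@big_delta _ (msupp y) (fun l' => (b@_i' * y@_l') *: v) l); last first.
  by move=> /mcoeff_outdom ->; rewrite mulr0 scale0r.
rewrite -sumrMnl; apply: eq_bigr => l' _.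
by rewrite mcoeffU xpair_eqE; do 2!case: eqP.
Qed.

Lemma tspaceP w w' : (forall i l, w@_(i, l) = w'@_(i, l)) -> w = w'.
Proof. by move=> ww; apply/malgP => -[]. Qed.

Lemma tcoefD w w' (i : K) : (w + w' : tspace V)@_i = w@_i + w'@_i.
Proof. exact: mcoeffD. Qed.

Lemma tcoefZ a w (i : K) : (a *: w : tspace V)@_i = a *: w@_i.
Proof. exact: tscaleE. Qed.

Lemma tcoef_lin a w w' (i : K) :
  (a *: w + w' : tspace V)@_i = a *: w@_i + w'@_i.
Proof. exact: etrans (tcoefD _ _ _) (congr1 (+%R^~ _) (tcoefZ _ _ _)). Qed.

Lemma tens_combination a v b y v1 b1 y1 v2 b2 y2 :
  (forall i l, (b@_i * y@_l) *: v =
     a *: ((b1@_i * y1@_l) *: v1) + (b2@_i * y2@_l) *: v2) ->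
  tens v b y = a *: tens v1 b1 y1 + tens v2 b2 y2.
Proof.
move=> e; apply: tspaceP => i l; apply: etrans (tens_coef v b y i l) _.
apply: etrans (e i l) (esym (etrans (tcoef_lin _ _ _ _) _)).
have key (p q p' q' : V) : p = p' -> q = q' -> a *: p + q = a *: p' + q'.
  by move=> -> ->.
by apply: key; apply: tens_coef.
Qed.

Lemma tens_linear1 b y : linear (fun v => tens v b y).
Proof.
move=> a u v; apply: tens_combination => i l.
by move: (b@_i * y@_l) => c; rewrite scalerDr !scalerA mulrC.
Qed.

Lemma malg_coef_lin (I : choiceType) a (x x' : {malg C[I]}) i :
  (a *: x + x')@_i = a * x@_i + x'@_i.
Proof. exact: etrans (mcoeffD _ _ _) (congr1 (+%R^~ _) (mcoeffZ _ _ _)). Qed.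

Lemma tens_linear2 v y : linear (fun b => tens v b y).
Proof.
move=> a b b'; apply: tens_combination => i l; rewrite (malg_coef_lin a b b' i).
by move: (b@_i) (b'@_i) (y@_l) => p q r; rewrite mulrDl scalerDl scalerA mulrA.
Qed.

Lemma tens_linear3 v b : linear (fun y => tens v b y).
Proof.
move=> a y y'; apply: tens_combination => i l; rewrite (malg_coef_lin a y y' l).
move: (b@_i) (y@_l) (y'@_l) => p q r.
by rewrite mulrDr scalerDl scalerA mulrCA.
Qed.

Lemma tens_basis v (i : bos_idx C) (l : fer_idx) :
  tens v << i >> << l >> = (<< v *g (i, l) >> : {malg V[K]}).
Proof.
apply: tspaceP => i' l'; rewrite tens_coef !mcoeffU xpair_eqE -natrM mulnb.
by case: (_ && _); rewrite ?scale1r ?scale0r.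
Qed.

Lemma tspace_basis w : w = \sum_(i <- msupp w) tens w@_i << i.1 >> << i.2 >>.
Proof.
rewrite [LHS]monalgE; apply: eq_bigr => -[i l] _; exact/esym/tens_basis.
Qed.

Section Extension.
Variables (T : lmodType C) (Phi : K -> V -> T).
Hypothesis linPhi : forall i, linear (Phi i).

Let ext w := \sum_(i <- msupp w) Phi i w@_i.

(** The operators [onV], [onBos] and [onFer] all have the form [ext], so their linearity and their
    values on basis tensors are proved once. *)
Lemma tspace_ext_linear : linear ext.
Proof.
move=> a w w'; pose D := (msupp (a *: w + w') `|` (msupp w `|` msupp w'))%fset.
rewrite /ext !(@big_msupp_widen _ _ _ _ D Phi); do 1?[by move=> i; apply: lin0].
- rewrite scaler_sumr -big_split; apply: eq_bigr => i _ /=.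
  by rewrite tcoefD tcoefZ linPhi.
- by rewrite /D fsubsetU// fsubsetUr orbT.
- by rewrite /D fsubsetU// fsubsetUl orbT.
- by rewrite /D fsubsetUl.
Qed.

Lemma tspace_ext_basis v i l : ext (tens v << i >> << l >>) = Phi (i, l) v.
Proof.
rewrite tens_basis /ext (@big_msupp_widen _ _ _ _ [fset (i, l)]%fset Phi).
- by rewrite big_seq_fset1 mcoeffUU.
- by move=> j; apply: lin0.
- exact: msuppU_le.
Qed.

End Extension.

Lemma bilinear_ext (T : lmodType C) (f g : bos C -> fer C -> T) b y :
  (forall y, linear (f^~ y)) -> (forall b, linear (f b)) ->
  (forall y, linear (g^~ y)) -> (forall b, linear (g b)) ->
  (forall i l, f << i >> << l >> = g << i >> << l >>) -> f b y = g b y.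
Proof.
move=> f1 f2 g1 g2 fg; move: b; apply: malg_eq => // i.
by move: y; apply: malg_eq.
Qed.

Lemma tspace_eq (T : lmodType C) (f g : tspace V -> T) :
  linear f -> linear g ->
  (forall v b y, f (tens v b y) = g (tens v b y)) -> f =1 g.
Proof.
move=> lf lg fg w; rewrite [w]tspace_basis (lin_sum lf) (lin_sum lg).
by apply: eq_bigr.
Qed.

Lemma onV_linear (S : V -> V) : linear S -> linear (onV S).
Proof.
move=> lS; apply: (tspace_ext_linear (Phi := fun i v => tens (S v) << i.1 >> << i.2 >>)).
by move=> i a u v; rewrite lS tens_linear1.
Qed.

Lemma onBos_linear (S : bos C -> bos C) : linear (@onBos C V S).
Proof.
apply: (tspace_ext_linear (Phi := fun i v => tens v (S << i.1 >>) << i.2 >>)).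
by move=> i; exact: tens_linear1.
Qed.

Lemma onFer_linear (par : V -> V) (S : fer C -> fer C) :
  linear par -> linear (onFer par S).
Proof.
move=> lp; apply: (tspace_ext_linear
  (Phi := fun i v => tens (par v) << i.1 >> (S << i.2 >>))).
by move=> i a u v; rewrite lp tens_linear1.
Qed.

Lemma onV_tens (S : V -> V) v b y : linear S ->
  onV S (tens v b y) = tens (S v) b y.
Proof.
move=> lS; apply: (bilinear_ext (f := fun b y => onV S (tens v b y))
  (g := fun b y => tens (S v) b y)).
- by move=> y'; exact: linear_comp (onV_linear lS) (tens_linear2 v y').
- by move=> b'; exact: linear_comp (onV_linear lS) (tens_linear3 v b').
- exact: tens_linear2.
- exact: tens_linear3.
move=> i l.
apply: (tspace_ext_basis (Phi := fun i v => tens (S v) << i.1 >> << i.2 >>)).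
by move=> {}i a u {}v; rewrite lS tens_linear1.
Qed.

Lemma onBos_tens (S : bos C -> bos C) v b y : linear S ->
  onBos S (tens v b y) = tens v (S b) y.
Proof.
move=> lS; apply: (bilinear_ext (f := fun b y => onBos S (tens v b y))
  (g := fun b y => tens v (S b) y)).
- by move=> y'; exact: linear_comp (onBos_linear S) (tens_linear2 v y').
- by move=> b'; exact: linear_comp (onBos_linear S) (tens_linear3 v b').
- by move=> y'; exact: linear_comp (tens_linear2 v y') lS.
- by move=> b'; exact: tens_linear3.
move=> i l.
apply: (tspace_ext_basis (Phi := fun i v => tens v (S << i.1 >>) << i.2 >>)).
by move=> {}i; exact: tens_linear1.
Qed.

Lemma onFer_tens (par : V -> V) (S : fer C -> fer C) v b y :
  linear par -> linear S -> onFer par S (tens v b y) = tens (par v) b (S y).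
Proof.
move=> lp lS; apply: (bilinear_ext (f := fun b y => onFer par S (tens v b y))
  (g := fun b y => tens (par v) b (S y))).
- by move=> y'; exact: linear_comp (onFer_linear S lp) (tens_linear2 v y').
- by move=> b'; exact: linear_comp (onFer_linear S lp) (tens_linear3 v b').
- by move=> y'; exact: tens_linear2.
- by move=> b'; exact: linear_comp (tens_linear3 (par v) b') lS.
move=> i l.
apply: (tspace_ext_basis
  (Phi := fun i v => tens (par v) << i.1 >> (S << i.2 >>))).
by move=> {}i a u {}v; rewrite lp tens_linear1.
Qed.

Section Families.
Variables (X : int -> V -> V) (B : int -> bos C -> bos C).
Variables (S : int -> fer C -> fer C) (par : V -> V).
Hypotheses (fX : isfield X) (fB : isfield B) (fS : isfield S).
Hypothesis linpar : linear par.

Lemma isfield_onV : isfield (fun n => onV (X n)).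
Proof.
have [lX bX] := fX; split=> [n|w]; first exact/onV_linear/lX.
rewrite [w]tspace_basis.
apply: (bounded_sum (fun n => onV_linear (lX n))) => i.
have [N XN] := bX w@_i; exists N => n /XN; rewrite onV_tens// => ->.
exact: lin0 (tens_linear1 _ _).
Qed.

Lemma isfield_onBos : isfield (fun n => @onBos C V (B n)).
Proof.
have [lB bB] := fB; split=> [n|w]; first exact: onBos_linear.
rewrite [w]tspace_basis.
apply: (bounded_sum (fun n => onBos_linear (B n))) => i.
have [N BN] := bB << i.1 >>; exists N => n /BN; rewrite onBos_tens// => ->.
exact: lin0 (tens_linear2 _ _).
Qed.

Lemma isfield_onFer : isfield (fun n => onFer par (S n)).
Proof.
have [lS bS] := fS; split=> [n|w]; first exact: onFer_linear.
rewrite [w]tspace_basis.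
apply: (bounded_sum (fun n => onFer_linear (S n) linpar)) => i.
have [N SN] := bS << i.2 >>; exists N => n /SN; rewrite onFer_tens// => ->.
exact: lin0 (tens_linear3 _ _).
Qed.

End Families.

Section Transport.
Context {T : lmodType C}.
Variables (f g h : T -> T) (t fg_t gf_t h_t g_t f_t : T).
Hypotheses (g_tE : g t = g_t) (fg_tE : f g_t = fg_t).
Hypotheses (f_tE : f t = f_t) (gf_tE : g f_t = gf_t) (h_tE : h t = h_t).

(** The hypotheses record the values of all operators along one pure tensor t; a commutation
    relation at t becomes a relation between these values. *)
Lemma transport_comm s c : fg_t = s *: gf_t + c *: h_t ->
  f (g t) = s *: g (f t) + c *: h t.
Proof. by rewrite g_tE f_tE fg_tE gf_tE h_tE. Qed.

Lemma transport_sign s : fg_t = s *: gf_t -> f (g t) = s *: g (f t).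
Proof. by rewrite g_tE f_tE fg_tE gf_tE. Qed.

End Transport.

Section Commutation.
Variables (X : V -> V) (B D : bos C -> bos C) (S P : fer C -> fer C).
Variable par : V -> V.
Hypotheses (lX : linear X) (lB : linear B) (lD : linear D).
Hypotheses (lS : linear S) (lP : linear P) (lp : linear par).

Let oX := onV_linear lX.
Let oB := onBos_linear B.
Let oD := onBos_linear D.
Let oS := onFer_linear S lp.
Let oP := onFer_linear P lp.

(** The term with Z serves two purposes: t = 0 for two vertex operators, and Z a shifted vertex mode
    for [dF] against a vertex operator. *)
Lemma onBos_onBos t (Z : bos C -> bos C) w : linear Z ->
  (forall b, B (D b) = 1 *: D (B b) + t *: Z b) ->
  @onBos C V B (onBos D w) = 1 *: onBos D (onBos B w) + t *: onBos Z w.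
Proof.
move=> lZ BD; move: w; apply: tspace_eq; first exact: linear_comp oB oD.
  exact: linear_add (linear_scale_fun (1 : C) (linear_comp oD oB))
    (linear_scale_fun t (onBos_linear Z)).
move=> v b y; apply: (transport_comm (onBos_tens v b y lD) (onBos_tens v _ y lB)
  (onBos_tens v b y lB) (onBos_tens v _ y lD) (onBos_tens v b y lZ)).
rewrite BD (tens_linear2 v y 1 (D (B b)) (t *: Z b)).
by rewrite (linZ (tens_linear2 v y) t (Z b)).
Qed.

Lemma onFer_onFer w : (forall v, par (par v) = v) ->
  (forall y, S (P y) = - P (S y)) ->
  onFer par S (onFer par P w) = - onFer par P (onFer par S w).
Proof.
move=> parK SP.
apply: etrans (scaleN1r (onFer par P (onFer par S w))); move: w; apply: tspace_eq.
- exact: linear_comp oS oP.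
- exact: (linear_scale_fun (-1 : C) (linear_comp oP oS)).
move=> v b y; apply: (transport_sign (onFer_tens v b y lp lP)
  (onFer_tens _ b _ lp lS) (onFer_tens v b y lp lS) (onFer_tens _ b _ lp lP)).
by rewrite parK SP -scaleN1r (linZ (tens_linear3 v b) (-1) (P (S y))).
Qed.

Lemma onV_onBos w : onV X (onBos B w) = onBos B (onV X w).
Proof.
move: w; apply: tspace_eq.
- exact: linear_comp oX oB.
- exact: linear_comp oB oX.
move=> v b y.
apply: etrans (etrans (congr1 _ (onBos_tens v b y lB)) (onV_tens v _ y lX)) _.
exact: esym (etrans (congr1 _ (onV_tens v b y lX)) (onBos_tens _ b y lB)).
Qed.

Lemma onFer_onBos w : onFer par S (onBos B w) = onBos B (onFer par S w).
Proof.
move: w; apply: tspace_eq.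
- exact: linear_comp oS oB.
- exact: linear_comp oB oS.
move=> v b y.
apply: etrans (etrans (congr1 _ (onBos_tens v b y lB)) (onFer_tens v _ y lp lS)) _.
exact: esym (etrans (congr1 _ (onFer_tens v b y lp lS)) (onBos_tens _ b _ lB)).
Qed.

(** With s = -1 for odd X, the parity inside [onFer] is what makes the free fermions anticommute
    with G and Q. *)
Lemma onFer_onV s w : (forall v, par (X v) = s *: X (par v)) ->
  onFer par S (onV X w) = s *: onV X (onFer par S w).
Proof.
move=> pX; move: w; apply: tspace_eq.
- exact: linear_comp oS oX.
- exact: (linear_scale_fun s (linear_comp oX oS)).
move=> v b y; apply: (transport_sign (onV_tens v b y lX)
  (onFer_tens _ b y lp lS) (onFer_tens v b y lp lS) (onV_tens _ b _ lX)).
by rewrite pX (linZ (tens_linear1 b (S y)) s (X (par v))).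
Qed.

End Commutation.

End Tensor.

(** * The Verma module *)

Section Smooth.
Context {C : numFieldType} {c : C} {V : lmodType C} (rho : n2rep c V).
Implicit Types (u : V) (m n : int).

Local Notation L := (n2L rho).
Local Notation H := (n2H rho).
Local Notation G := (n2G rho).
Local Notation Q := (n2Q rho).

Definition smooth_from (N : nat) u := forall n, N%:Z <= n ->
  [/\ L n u = 0, H n u = 0, G n u = 0 & Q n u = 0].

Definition smooth u := exists N, smooth_from N u.

Lemma n2_swap (A B : V -> V) u z : comm A B u = z -> A (B u) = B (A u) + z.
Proof. by move=> <-; rewrite /comm addrC subrK. Qed.

Lemma n2_swapN (A B : V -> V) u z : comm A B u = z -> B (A u) = A (B u) - z.
Proof. by move=> <-; rewrite /comm subKr. Qed.

Lemma n2_aswap (A B : V -> V) u z : acomm A B u = z -> A (B u) = - B (A u) + z.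
Proof. by move=> <-; rewrite /acomm addrCA addNr addr0. Qed.

Lemma n2_aswapN (A B : V -> V) u z : acomm A B u = z -> B (A u) = - A (B u) + z.
Proof. by move=> <-; rewrite /acomm addKr. Qed.

Lemma smooth_L m u : smooth u -> smooth (L m u).
Proof.
(* The bound keeps both n and m + n at least N; the successor also makes m + n positive, so that the
   central terms vanish. *)
move=> [N uN]; exists (N + absz m).+1 => n Nn.
have [Ln Hn Gn Qn] := uN n ltac:(lia).
have [Lmn Hmn Gmn Qmn] := uN (m + n) ltac:(lia).
have nm : (m + n == 0) = false by lia.
split.
- by rewrite (n2_swapN (n2LL rho m n u)) Ln Lmn scaler0 subr0 linear0.
- rewrite (n2_swapN (n2LH rho m n u)) Hn Hmn nm mulr0 scale0r.
  by rewrite scaler0 addr0 subr0 linear0.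
- by rewrite (n2_swapN (n2LG rho m n u)) Gn Gmn scaler0 subr0 linear0.
- by rewrite (n2_swapN (n2LQ rho m n u)) Qn Qmn scaler0 subr0 linear0.
Qed.

Lemma smooth_H m u : smooth u -> smooth (H m u).
Proof.
move=> [N uN]; exists (N + absz m).+1 => n Nn.
have [Ln Hn Gn Qn] := uN n ltac:(lia).
have [Lmn Hmn Gmn Qmn] := uN (m + n) ltac:(lia).
have nm : (m + n == 0) = false by lia.
split.
- rewrite (n2_swap (n2LH rho n m u)) Ln [n + m]addrC Hmn nm mulr0 scale0r.
  by rewrite scaler0 !addr0 linear0.
- by rewrite (n2_swapN (n2HH rho m n u)) Hn nm mulr0 scale0r subr0 linear0.
- by rewrite (n2_swapN (n2HG rho m n u)) Gn Gmn subr0 linear0.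
- by rewrite (n2_swapN (n2HQ rho m n u)) Qn Qmn oppr0 subr0 linear0.
Qed.

Lemma smooth_G m u : smooth u -> smooth (G m u).
Proof.
move=> [N uN]; exists (N + absz m).+1 => n Nn.
have [Ln Hn Gn Qn] := uN n ltac:(lia).
have [Lmn Hmn Gmn Qmn] := uN (m + n) ltac:(lia).
have nm : (m + n == 0) = false by lia.
split.
- by rewrite (n2_swap (n2LG rho n m u)) Ln [n + m]addrC Gmn scaler0 addr0 linear0.
- by rewrite (n2_swap (n2HG rho n m u)) Hn [n + m]addrC Gmn addr0 linear0.
- by rewrite (n2_aswap (n2GG rho n m u)) Gn addr0 linear0 oppr0.
- rewrite (n2_aswapN (n2GQ rho m n u)) Qn Lmn Hmn nm mulr0 scale0r.
  by rewrite !scaler0 subr0 !addr0 linear0 oppr0.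
Qed.

Lemma smooth_Q m u : smooth u -> smooth (Q m u).
Proof.
move=> [N uN]; exists (N + absz m).+1 => n Nn.
have [Ln Hn Gn Qn] := uN n ltac:(lia).
have [Lmn Hmn Gmn Qmn] := uN (m + n) ltac:(lia).
have nm : (m + n == 0) = false by lia.
split.
- by rewrite (n2_swap (n2LQ rho n m u)) Ln [n + m]addrC Qmn scaler0 addr0 linear0.
- by rewrite (n2_swap (n2HQ rho n m u)) Hn [n + m]addrC Qmn oppr0 addr0 linear0.
- rewrite (n2_aswap (n2GQ rho n m u)) Gn [n + m]addrC Lmn Hmn nm mulr0 scale0r.
  by rewrite !scaler0 subr0 !addr0 linear0 oppr0.
- by rewrite (n2_aswap (n2QQ rho n m u)) Qn addr0 linear0 oppr0.
Qed.

Lemma smooth_par u : smooth u -> smooth (n2par rho u).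
Proof.
move=> [N uN]; exists N => n /uN[Ln Hn Gn Qn]; split.
- by rewrite -n2parL Ln linear0.
- by rewrite -n2parH Hn linear0.
- by rewrite -[G _ _]opprK -n2parG Gn linear0 oppr0.
- by rewrite -[Q _ _]opprK -n2parQ Qn linear0 oppr0.
Qed.

Definition smoothp : {pred V} := fun u => `[< smooth u >].

Lemma smoothp_closed : submod_closed smoothp.
Proof.
split=> [|a u u' /asboolP[N uN] /asboolP[M uM]]; apply/asboolP.
  by exists 0%N => n _; rewrite !linear0.
exists (maxn N M) => n nN.
have [|L1 H1 G1 Q1] := uN n; first by lia.
have [|L2 H2 G2 Q2] := uM n; first by lia.
by split; rewrite linearP ?L1 ?L2 ?H1 ?H2 ?G1 ?G2 ?Q1 ?Q2 scaler0 addr0.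
Qed.

HB.instance Definition _ := GRing.isSubmodClosed.Build C V smoothp smoothp_closed.

(** The smooth vectors get a type of their own in order to carry an [n2rep] and be a target for the
    universal property. *)
Record smooth_space := SmoothVector { sv : V; _ : sv \in smoothp }.

HB.instance Definition _ := [isSub for sv].
HB.instance Definition _ := [Choice of smooth_space by <:].
HB.instance Definition _ := [SubChoice_isSubLmodule of smooth_space by <:].

Lemma sv_smooth (x : smooth_space) : smooth (sv x).
Proof. by apply/asboolP; case: x. Qed.

Definition restr (A : {linear V -> V}) (hA : forall u, smooth u -> smooth (A u))
    (x : smooth_space) : smooth_space :=
  @SmoothVector (A (sv x)) (asboolT (hA _ (sv_smooth x))).

Lemma restr_linear A hA : linear (@restr A hA).
Proof. by move=> a x y; apply: val_inj; rewrite /= linearP. Qed.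

HB.instance Definition _ A hA :=
  GRing.isLinear.Build C smooth_space smooth_space _ (@restr A hA)
    (@restr_linear A hA).

Lemma smooth_rep_subproof : exists sigma : n2rep c smooth_space,
  [/\ forall n x, sv (n2L sigma n x) = L n (sv x),
      forall n x, sv (n2H sigma n x) = H n (sv x),
      forall n x, sv (n2G sigma n x) = G n (sv x),
      forall n x, sv (n2Q sigma n x) = Q n (sv x)
    & forall x, sv (n2par sigma x) = n2par rho (sv x)].
Proof.
pose L' n := restr (@smooth_L n) : {linear _ -> _}.
pose H' n := restr (@smooth_H n) : {linear _ -> _}.
pose G' n := restr (@smooth_G n) : {linear _ -> _}.
pose Q' n := restr (@smooth_Q n) : {linear _ -> _}.
pose par' := restr smooth_par : {linear _ -> _}.
unshelve eexists (@N2Rep C c smooth_space L' H' G' Q' par'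
  _ _ _ _ _ _ _ _ _ _ _ _ _ _ _) => //.
all: try move=> m; try move=> n; try move=> x; apply: val_inj => /=.
- exact: n2LL.
- exact: n2HH.
- exact: n2LG.
- exact: n2HG.
- exact: n2LQ.
- exact: n2HQ.
- exact: n2LH.
- exact: n2GQ.
- exact: n2GG.
- exact: n2QQ.
- exact: n2parK.
- exact: n2parL.
- exact: n2parH.
- exact: n2parG.
- exact: n2parQ.
Qed.

End Smooth.

(** Universality gives a morphism from V to the smooth vectors that sends v to v. Followed by the
    inclusion it is an endomorphism fixing v, hence the identity by uniqueness, so every vector is
    smooth. *)
Lemma verma_smooth (C : numFieldType) (c : C) (V : lmodType C)
    (rho : n2rep c V) h l v u : n2_verma rho h l v -> smooth rho u.
Proof.
move=> [hwv univ]; have [sigma [sL sH sG sQ spar]] := smooth_rep_subproof rho.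
have [Qv Gv LHv [H0v L0v] parv] := hwv.
have vs : v \in smoothp rho.
  apply/asboolP; exists 1%N => n n1; have [Ln Hn] := LHv n n1.
  by rewrite Ln Hn Gv ?Qv//; lia.
pose w := SmoothVector vs.
have hww : n2_hw sigma h l w.
  split=> [n n1|n n0|n n1||]; do ?split; apply: val_inj => /=.
  - by rewrite [LHS]sQ Qv.
  - by rewrite [LHS]sG Gv.
  - by rewrite [LHS]sL (LHv n n1).1.
  - by rewrite [LHS]sH (LHv n n1).2.
  - by rewrite [LHS]sH H0v.
  - by rewrite [LHS]sL L0v.
  - by rewrite [LHS]spar parv.
have [[f [fL fH fG fQ fp] fv] _] := univ _ sigma w hww.
have [_ uniq_hom] := univ _ rho v hwv.
pose g : {linear V -> V} := (val : smooth_space rho -> V) \o f.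
have -> : u = g u.
  apply: (uniq_hom idfun g) => //=; last by rewrite /g /= fv.
  split=> [n x|n x|n x|n x|x]; rewrite /g /=.
  - by rewrite fL; apply: sL.
  - by rewrite fH; apply: sH.
  - by rewrite fG; apply: sG.
  - by rewrite fQ; apply: sQ.
  - by rewrite fp; apply: spar.
exact: sv_smooth.
Qed.

(** * The currents *)

Section CurrentAlgebra.
Context {C : numFieldType} {T : lmodType C}.
Implicit Types (x : T) (m n i : int).
Variables (X H D V W chi : int -> T -> T) (c al be ga de : C).
Hypotheses (fX : isfield X) (fH : isfield H) (fD : isfield D).
Hypotheses (fV : isfield V) (fW : isfield W) (fchi : isfield chi).
Hypothesis chichi : forall m n x, chi m (chi n x) = - chi n (chi m x).
Hypothesis chiX : forall m n x, chi m (X n x) = - X n (chi m x).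
Hypothesis chiH : forall m n x, chi m (H n x) = H n (chi m x).
Hypothesis chiD : forall m n x, chi m (D n x) = D n (chi m x).
Hypothesis chiV : forall m n x, chi m (V n x) = V n (chi m x).
Hypothesis chiW : forall m n x, chi m (W n x) = W n (chi m x).
Hypothesis XV : forall m n x, X m (V n x) = V n (X m x).
Hypothesis XW : forall m n x, X m (W n x) = W n (X m x).
Hypothesis HV : forall m n x, H m (V n x) = V n (H m x).
Hypothesis HW : forall m n x, H m (W n x) = W n (H m x).
Hypothesis VW : forall m n x, V m (W n x) = W n (V m x).
Hypothesis DV : forall m n x, D m (V n x) = V n (D m x) + c *: V (n + m) x.

Definition even_cur n x : T := nop chi V n x.

Definition odd_cur n x : T :=
  al *: nop X W n x + be *: nop chi (nop D W) n x
  + ga *: nop H (nop chi W) n x + de *: nop (dfield chi) W n x.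

Let E := even_cur.
Let B := nop D W.
Let Z := nop chi W.
Let Y := nop V W.

Let lchi n : linear (chi n). Proof. exact: fchi.1. Qed.
Let lX n : linear (X n). Proof. exact: fX.1. Qed.
Let lH n : linear (H n). Proof. exact: fH.1. Qed.
Let lV n : linear (V n). Proof. exact: fV.1. Qed.
Let lW n : linear (W n). Proof. exact: fW.1. Qed.
Let lD n : linear (D n). Proof. exact: fD.1. Qed.
Let fB : isfield B. Proof. exact: isfield_nop. Qed.
Let fZ : isfield Z. Proof. exact: isfield_nop. Qed.
Let fY : isfield Y. Proof. exact: isfield_nop. Qed.
Let fdchi : isfield (dfield chi). Proof. exact: isfield_dfield. Qed.

Lemma even_cur_field : isfield E.
Proof. exact: isfield_nop. Qed.

Lemma odd_cur_linear n : linear (odd_cur n).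
Proof.
exact: (linear_add (linear_add (linear_add
  (linear_scale_fun al ((isfield_nop fX fW).1 n))
  (linear_scale_fun be ((isfield_nop fchi fB).1 n)))
  (linear_scale_fun ga ((isfield_nop fH fZ).1 n)))
  (linear_scale_fun de ((isfield_nop fdchi fW).1 n))).
Qed.

Let lE n : linear (E n). Proof. exact: even_cur_field.1. Qed.

Let signE s (F : T -> T) m x : linear F ->
  (forall i x, F (chi i x) = s *: chi i (F x)) ->
  (forall i x, F (V i x) = V i (F x)) -> F (E m x) = s *: E m (F x).
Proof.
move=> lF Fchi FV; rewrite /E /even_cur (nop_sign fchi fV m x (s := s) (t := 1))//.
  by rewrite mulr1.
by move=> i y; rewrite FV scale1r.
Qed.

Let EX m n x : E m (X n x) = (-1) *: X n (E m x).
Proof.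
by rewrite (signE (s := -1))// ?scalerA ?mulrNN ?mulr1 ?scale1r// => i y;
  rewrite scaleN1r chiX opprK.
Qed.

Let EH m n x : E m (H n x) = 1 *: H n (E m x).
Proof.
by rewrite (signE (s := 1))// ?scale1r// => i y; rewrite scale1r chiH.
Qed.

Let EW m n x : E m (W n x) = 1 *: W n (E m x).
Proof.
by rewrite (signE (s := 1))// ?scale1r// => i y; rewrite ?scale1r ?chiW ?VW.
Qed.

Let Echi m n x : E m (chi n x) = (-1) *: chi n (E m x).
Proof.
by rewrite (signE (s := -1))// ?scalerA ?mulrNN ?mulr1 ?scale1r// => i y;
  rewrite scaleN1r chichi.
Qed.

Let Edchi m n x : E m (dfield chi n x) = (-1) *: dfield chi n (E m x).
Proof. by rewrite /dfield (linZ (lE _)) Echi !scalerA mulrC. Qed.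

Let EZ m n x : E m (Z n x) = (-1) *: Z n (E m x).
Proof. by rewrite (nop_sign fchi fW n x (s := -1) (t := 1)) ?mulr1. Qed.

Let chiB m n x : chi m (B n x) = B n (chi m x).
Proof.
rewrite (nop_sign fD fW n x (s := 1) (t := 1)) ?mulr1 ?scale1r// => i y.
  by rewrite scale1r chiD.
by rewrite scale1r chiW.
Qed.

Let chiY m n x : chi m (Y n x) = Y n (chi m x).
Proof.
rewrite (nop_sign fV fW n x (s := 1) (t := 1)) ?mulr1 ?scale1r// => i y.
  by rewrite scale1r chiV.
by rewrite scale1r chiW.
Qed.

Let VB m n x : V m (B n x) = B n (V m x) - c *: Y (n + m) x.
Proof.
rewrite (nop_derl fD fW n x (lV m) (A' := fun i y => (- c) *: V (i + m) y)).
- congr (_ + _); rewrite -scaleNr /Y -(nop_shiftl fV fW VW) zsumZ; last first.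
    exact: (fsupp_comm (isfield_shift m fV) fW (fun _ _ _ => VW _ _ _)).
  apply: eq_zsum => i; rewrite /nopt; case: ifP => // _.
  by rewrite (linZ (lW _)) VW.
- exact/isfield_scale/isfield_shift.
- by move=> i y; rewrite DV scaleNr [m + i]addrC addrK.
- by move=> i y; rewrite VW.
Qed.

Let EB m n x :
  E m (B n x) = B n (E m x) - c *: zsum (fun i => chi i (Y (n + m - 1 - i) x)).
Proof.
have lB : linear (B n) by exact: fB.1.
have lY : isfield (fun i y => c *: Y (i + n) y) by exact/isfield_scale/isfield_shift.
(* Here [E m] is the normal ordered product and [B n] the operator moved through it: [B n] commutes
   with chi, and its commutator with [V i] is c times [Y (i + n)]. *)
rewrite [B n (E m x)](nop_derr fchi fV m x lB (B' := fun i y => c *: Y (i + n) y))//.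
  have cY i j y : chi i (Y (j + n) y) = Y (j + n) (chi i y) by [].
  set S1 := zsum _; set S2 := zsum _; suff -> : S1 = c *: S2 by rewrite addrK.
  rewrite /S2 zsumZ; last first.
    have [N zN] := fsupp_comm fchi (isfield_shift n fY) cY m x.
    by exists N => i /zN <-; congr (chi _ (Y _ _)); lia.
  apply: eq_zsum => i; have e : m - 1 - i + n = n + m - 1 - i by lia.
  rewrite /nopt; case: ifP => _.
    by rewrite (linZ (lchi _)) e.
  by rewrite chiY e.
by move=> i y; rewrite VB [n + i]addrC subrK.
Qed.

Lemma even_odd_cur m n x : E m (odd_cur n x) = - odd_cur n (E m x).
Proof.
have chiBs y i j : chi i (B j y) = B j (chi i y) by [].
have t1 : E m (nop X W n x) = - nop X W n (E m x).
  by rewrite (nop_sign fX fW n x (s := -1) (t := 1)) ?mulr1 ?scaleN1r.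
have t3 : E m (nop H Z n x) = - nop H Z n (E m x).
  by rewrite (nop_sign fH fZ n x (s := 1) (t := -1)) ?mul1r ?scaleN1r.
have t4 : E m (nop (dfield chi) W n x) = - nop (dfield chi) W n (E m x).
  by rewrite (nop_sign fdchi fW n x (s := -1) (t := 1)) ?mulr1 ?scaleN1r.
have t2 : E m (nop chi B n x) = - nop chi B n (E m x).
  rewrite !(nop_commE fchi fB chiB).
  have fs1 := fsupp_comm fchi fB chiB n x.
  have fs2 := fsupp_comm fchi fB chiB n (E m x).
  rewrite (zsum_lin (lE m) fs1) -scaleN1r (zsumZ _ fs2).
  apply/eqP; rewrite -subr_eq0 -scaleN1r (zsumZ _ (fsuppZ _ fs2)).
  rewrite -zsumD; last 2 first.
  - exact: fsupp_lin (lE m) fs1.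
  - exact/fsuppZ/fsuppZ.
  (* Moving [E m] past chi_i and B_(n-1-i) leaves chi_i chi_l Y, where Y has index (n - 1 - i) + m -
     1 - l; so the antisymmetric sum has q = n + m - 2. *)
  have := zsum_anticomm (n + m - 1 - 1) x _ fchi fY chichi chiY.
  rewrite pnatr_eq0 => /(_ isT) /= [fs0 S0]; apply/eqP.
  transitivity (c *: (0 : T)); last by rewrite scaler0.
  rewrite -S0 (zsumZ _ fs0); apply: eq_zsum => i; rewrite Echi EB.
  rewrite (linD (lchi i)) (linN (lchi i)) (linZ (lchi i)) scalerBr.
  rewrite !scaleN1r !opprK addrAC addNr add0r; congr (_ *: chi i _).
  apply: eq_zsum => l.
  by have -> : n - 1 - i + m - 1 - l = n + m - 1 - 1 - i - l by lia.
by rewrite /odd_cur !(linD (lE m)) !(linZ (lE m)) t1 t2 t3 t4 !scalerN !opprD.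
Qed.

(** Each product collapses to a single term: the vanishing conditions leave [W (-1)], the zero modes
    of D and H, and the top modes of X and chi, namely X_(-n) and chi_(-n-1). The coefficient n
    comes from the derivative of chi. *)
Lemma odd_cur_eval (s n : nat) (t : T) (h d : C) : (n <= s)%N ->
  (forall p, 0 <= p -> W p t = 0) -> (forall i, - n%:Z < i -> X i t = 0) ->
  (forall i, - s%:Z <= i -> chi i t = 0) ->
  (forall i, 0 < i -> H i t = 0) -> H 0 t = h *: t ->
  (forall i, 0 < i -> D i t = 0) -> D 0 t = d *: t ->
  odd_cur (- n%:Z) t = al *: X (- n%:Z) (W (-1) t) +
    (be * d + ga * h + de * n%:R) *: W (-1) (chi (- n%:Z - 1) t).
Proof.
move=> ns Wt Xt ct Ht H0t Dt D0t.
have chiBs i j y : chi i (B j y) = B j (chi i y) by [].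
have HZ i j y : H i (Z j y) = Z j (H i y).
  by rewrite (nop_sign fchi fW _ _ (s := 1) (t := 1)) ?mulr1 ?scale1r// => l z;
    rewrite scale1r.
have dchiW i j y : dfield chi i (W j y) = W j (dfield chi i y).
  by rewrite /dfield chiW (linZ (lW j)).
have Bt p : 0 <= p -> B p t = d *: W (p - 1) t.
  move=> p0; rewrite /B (nopE fD fW) (@zsum_single _ _ 0) => [|i i0].
    by rewrite /nopt /= subr0 D0t (linZ (lW _)).
  rewrite /nopt; case: ifP => i_lt; first by rewrite Wt ?(lin0 (lD _))//; lia.
  by rewrite Dt ?(lin0 (lW _))//; lia.
have Zt p : - s%:Z - 1 <= p -> Z p t = W (-1) (chi p t).
  move=> ps; rewrite /Z (nop_single fchi fW chiW (i0 := p)) => [|i ip].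
    by rewrite (_ : p - 1 - p = -1) ?chiW//; lia.
  have [pi|pi] := ltP p i; first by rewrite chiW ct ?(lin0 (lW _))//; lia.
  by rewrite Wt ?(lin0 (lchi _))//; lia.
have t1 : nop X W (- n%:Z) t = X (- n%:Z) (W (-1) t).
  rewrite (nop_single fX fW XW (i0 := - n%:Z)) => [|i ni].
    by congr (X _ (W _ _)); lia.
  have [i_gt|i_le] := ltP (- n%:Z) i; first by rewrite XW Xt ?(lin0 (lW _))//; lia.
  by rewrite Wt ?(lin0 (lX _))//; lia.
have t2 : nop chi B (- n%:Z) t = d *: W (-1) (chi (- n%:Z - 1) t).
  rewrite (nop_single fchi fB chiB (i0 := - n%:Z - 1)) => [|i ni].
    by rewrite Bt ?(linZ (lchi _)) ?chiW; [congr (_ *: W _ _)|]; lia.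
  have [i_gt|i_le] := ltP (- n%:Z - 1) i.
    by rewrite chiB ct ?(lin0 (fB.1 _))//; lia.
  by rewrite Bt ?Wt ?scaler0 ?(lin0 (lchi _))//; lia.
have t3 : nop H Z (- n%:Z) t = h *: W (-1) (chi (- n%:Z - 1) t).
  rewrite (nop_single fH fZ HZ (i0 := 0)) => [|i i0].
    rewrite subr0 HZ H0t (linZ (fZ.1 _)) Zt//; lia.
  have [i_gt|i_le] := ltP 0 i; first by rewrite HZ Ht ?(lin0 (fZ.1 _)).
  by rewrite Zt ?ct ?(lin0 (lW _)) ?(lin0 (lH _))//; lia.
have t4 : nop (dfield chi) W (- n%:Z) t = n%:R *: W (-1) (chi (- n%:Z - 1) t).
  rewrite (nop_single fdchi fW dchiW (i0 := - n%:Z)) => [|i ni].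
    rewrite (_ : - n%:Z - 1 - - n%:Z = -1); last by lia.
    by rewrite /dfield chiW mulrNz opprK.
  have [i_gt|i_le] := ltP (- n%:Z) i.
    by rewrite dchiW /dfield ct ?scaler0 ?(lin0 (lW _))//; lia.
  by rewrite Wt ?(lin0 (fdchi.1 _))//; lia.
by rewrite /odd_cur t1 t2 t3 t4 !scalerA !scalerDl !addrA.
Qed.

End CurrentAlgebra.

(** * Strings of consecutive anticommuting modes *)

Section Strings.
Context {C : numFieldType} {T : lmodType C}.
Implicit Types (A B H : int -> T -> T) (x : T) (c i : int) (t s : nat).

(** This is [modes] with top mode c and length t, arranged so that induction peels off the leftmost,
    lowest mode. *)
Fixpoint down A c t x : T :=
  if t is t'.+1 then A (c - t'%:Z) (down A c t' x) else x.

Lemma modes_down A c t x : modes A (c - t%:Z + 1) c x = down A c t x.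
Proof.
rewrite /modes.
have gen (m : int) (a u : nat) : m + a%:Z + u%:Z = c + 1 ->
    foldr (fun (i : nat) y => A (m + i%:Z) y) x (iota a u) = down A c u x.
  elim: u a => [//|u IH] a e /=; rewrite IH; last by lia.
  by congr (A _ _); lia.
case: ifP => ct; last by have -> : t = 0%N by lia.
by rewrite (_ : _.+1 = t) ?gen//; lia.
Qed.

Lemma down_shift A m c t x :
  down (fun n => A (n + m)) c t x = down A (c + m) t x.
Proof. by elim: t => [//|t IH] /=; rewrite IH addrAC. Qed.

Lemma down_swap A B c c' s t x :
  (forall n, linear (A n)) -> (forall n, linear (B n)) ->
  (forall m n x, A m (B n x) = - B n (A m x)) ->
  down A c s (down B c' t x) = (-1) ^+ (s * t) *: down B c' t (down A c s x).
Proof.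
move=> lA lB AB.
have AdB m y : A m (down B c' t y) = (-1) ^+ t *: down B c' t (A m y).
  elim: t => [|t IH] /=; first by rewrite scale1r.
  by rewrite AB IH (linZ (lB _)) exprS mulN1r scaleNr.
elim: s => [|s IH] /=; first by rewrite mul0n scale1r.
by rewrite IH (linZ (lA _)) AdB scalerA -exprD mulSnr.
Qed.

(** A mode that occurs in the string can be moved next to its copy, where its square vanishes; a
    mode above c passes through to x. *)
Lemma down_kill A c t x : (forall n, linear (A n)) ->
  (forall m n x, A m (A n x) = - A n (A m x)) ->
  (forall i, c < i -> A i x = 0) ->
  forall i, c - t%:Z < i -> A i (down A c t x) = 0.
Proof.
move=> lA AA Ax; elim: t => [|t IH] i ci /=; first by apply: Ax; lia.
have [->|ni] := eqVneq i (c - t%:Z); last first.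
  have ci' : c - t%:Z < i by move/eqP: ni => ni; lia.
  by rewrite AA IH// (lin0 (lA _)) oppr0.
set y := A _ _; suff : 2%:R *: y = 0.
  by move/eqP; rewrite scaler_eq0 pnatr_eq0 => /eqP.
by rewrite scaler_nat mulr2n {1}/y AA addNr.
Qed.

(** Each factor changes the H_0 charge by e. A positive mode of H turns a factor into a higher mode
    of A, which occurs further to the right or kills x. *)
Lemma down_weight H A e h t x : (forall n, linear (A n)) ->
  (forall i, linear (H i)) ->
  (forall m n x, A m (A n x) = - A n (A m x)) ->
  (forall m n x, H m (A n x) = A n (H m x) + e *: A (m + n) x) ->
  (forall i, 0 < i -> A i x = 0) -> (forall i, 0 < i -> H i x = 0) ->
  H 0 x = h *: x ->
  (forall i, 0 < i -> H i (down A 0 t x) = 0) /\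
  H 0 (down A 0 t x) = (h + e * t%:R) *: down A 0 t x.
Proof.
move=> lA lH AA HA Ax Hx H0x; elim: t => [|t [IH IH0]] /=.
  by rewrite mulr0 addr0.
split=> [i i0|].
  rewrite HA IH// (lin0 (lA _)) (down_kill lA AA Ax) ?scaler0 ?addr0//; lia.
by rewrite HA !add0r IH0 (linZ (lA _)) -scalerDl -natr1 mulrDr mulr1 addrA.
Qed.

End Strings.

Lemma eq_scale1_add0 (C : pzRingType) (T : lmodType C) (x y z : T) :
  x = y -> x = 1 *: y + 0 *: z.
Proof. by move=> ->; rewrite scale1r scale0r addr0. Qed.

Lemma scale1_add0 (C : pzRingType) (T : lmodType C) (y z : T) :
  1 *: y + 0 *: z = y.
Proof. by rewrite scale1r scale0r addr0. Qed.

Lemma scale1_add (C : pzRingType) (T : lmodType C) (c : C) (y z : T) :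
  y + c *: z = 1 *: y + c *: z.
Proof. by rewrite scale1r. Qed.

(** * The currents on the tensor product *)

Section Realized.
Context {C : numFieldType} (k : C) {V : lmodType C}.
Variables (par : V -> V) (X H : int -> V -> V) (chi : int -> fer C -> fer C).
Variables (al be ga de e : C).
Hypothesis linpar : linear par.
Hypotheses (fX : isfield X) (fH : isfield H) (fchi : isfield chi).
Hypothesis parK : forall u, par (par u) = u.
Hypothesis parX : forall n u, par (X n u) = - X n (par u).
Hypothesis parH : forall n u, par (H n u) = H n (par u).
Hypothesis XX : forall m n u, X m (X n u) = - X n (X m u).
Hypothesis HX : forall m n u, H m (X n u) = X n (H m u) + e *: X (m + n) u.
Hypothesis chichi : forall m n y, chi m (chi n y) = - chi n (chi m y).

Local Notation T := (tspace V).
Let FX n : T -> T := onV (X n).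
Let FH n : T -> T := onV (H n).
Let FD n : T -> T := onBos (dF k n).
Let FV a n : T -> T := onBos (vertex k a n).
Let Fchi n : T -> T := onFer par (chi n).

Let lX n : linear (X n). Proof. exact: fX.1. Qed.
Let lH n : linear (H n). Proof. exact: fH.1. Qed.
Let lchi n : linear (chi n). Proof. exact: fchi.1. Qed.
Let lV a n : linear (vertex k a n). Proof. exact: (isfield_vertex k a).1. Qed.
Let lD n : linear (dF k n). Proof. exact: dF_linear. Qed.

Let fFX : isfield FX. Proof. exact: isfield_onV. Qed.
Let fFH : isfield FH. Proof. exact: isfield_onV. Qed.
Let fFD : isfield FD. Proof. exact: isfield_onBos (isfield_dF k). Qed.
Let fFV a : isfield (FV a). Proof. exact: isfield_onBos (isfield_vertex k a). Qed.
Let fFchi : isfield Fchi. Proof. exact: isfield_onFer. Qed.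

Let Fchichi m n w : Fchi m (Fchi n w) = - Fchi n (Fchi m w).
Proof. exact: onFer_onFer (lchi m) (lchi n) linpar w parK (chichi m n). Qed.

Let FchiX m n w : Fchi m (FX n w) = - FX n (Fchi m w).
Proof.
apply: etrans (scaleN1r _).
apply: (onFer_onV (lX n) (lchi m) linpar) => u.
by rewrite parX scaleN1r.
Qed.

Let FchiH m n w : Fchi m (FH n w) = FH n (Fchi m w).
Proof.
apply: etrans (scale1r _).
apply: (onFer_onV (lH n) (lchi m) linpar) => u.
by rewrite parH scale1r.
Qed.

Let FchiD m n w : Fchi m (FD n w) = FD n (Fchi m w).
Proof. exact: (onFer_onBos (lD n) (lchi m) linpar w). Qed.

Let FchiV a m n w : Fchi m (FV a n w) = FV a n (Fchi m w).
Proof. exact: (onFer_onBos (lV a n) (lchi m) linpar w). Qed.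

Let FXV a m n w : FX m (FV a n w) = FV a n (FX m w).
Proof. exact: (onV_onBos (lX m) (lV a n) w). Qed.

Let FHV a m n w : FH m (FV a n w) = FV a n (FH m w).
Proof. exact: (onV_onBos (lH m) (lV a n) w). Qed.

Let FVV a b m n w : FV a m (FV b n w) = FV b n (FV a m w).
Proof.
apply: etrans (onBos_onBos (t := 0) (lV a m) (lV b n) w (lV a m) _) _ => [y|].
  by apply: eq_scale1_add0; apply: vertex_comm.
exact: scale1_add0.
Qed.

Let FDV a m n w :
  FD m (FV a n w) = FV a n (FD m w) + (k / 2%:R * a) *: FV a (n + m) w.
Proof.
apply: etrans (onBos_onBos (t := k / 2%:R * a) (lD m) (lV a n) w (lV a (n + m)) _) _.
  by move=> y; apply: etrans (dF_vertex k a m n y) _; apply: scale1_add.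
exact/esym/scale1_add.
Qed.

Definition curE n (w : T) : T := even_cur (FV k^-1) Fchi n w.

(** One family for both cases: (al, be, ga, de) will be (1, -1, -1/2, -(k + 1/2)) for [curF1] and
    ((k + 1)/2, 1, -1/2, k + 1/2) for [curF2]. *)
Definition curF n (w : T) : T :=
  odd_cur FX FH FD (FV (- k^-1)) Fchi al be ga de n w.

Lemma curE_linear n : linear (curE n).
Proof. exact: (even_cur_field (fFV _) fFchi).1. Qed.

Lemma curF_linear n : linear (curF n).
Proof. exact: odd_cur_linear fFX fFH fFD (fFV _) fFchi n. Qed.

Lemma curE_curF m n w : curE m (curF n w) = - curF n (curE m w).
Proof.
exact: (even_odd_cur al be ga de fFX fFH fFD (fFV _) (fFV _) fFchi Fchichi FchiX FchiH
  FchiD (FchiV _) (FchiV _) (FXV _) (FHV _) (FVV _ _) (FDV _) m n w).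
Qed.

Section Evaluation.
Variables (a : C) (u : V) (y : fer C).
Local Notation t := (tens u (bos_vac a) y).

Let FV_t b p : -1 <= p ->
  FV b p t = if p == -1 then tens u (bos_vac (a + b)) y else 0.
Proof.
move=> p1; apply: etrans (onBos_tens u _ y (lV b p)) _.
have p1' : 0 <= p + 1 by lia.
apply: etrans (congr1 (fun z => tens u z y) (vertex_vac k b a p1')) _.
by case: eqP => // _; exact: lin0 (tens_linear2 u y).
Qed.

Let FV_t0 b p : 0 <= p -> FV b p t = 0.
Proof. by move=> p0; rewrite FV_t; [case: eqP => // ?|]; lia. Qed.

Let FV_t1 b : FV b (-1) t = tens u (bos_vac (a + b)) y.
Proof. by rewrite FV_t// eqxx. Qed.

Let Fchi_t i : Fchi i t = tens (par u) (bos_vac a) (chi i y).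
Proof. exact: onFer_tens. Qed.

Let Fchi_t0 i : chi i y = 0 -> Fchi i t = 0.
Proof. by move=> cy; rewrite Fchi_t cy; exact: lin0 (tens_linear3 _ _). Qed.

Let FD_t p : 0 <= p -> FD p t = (k * a / 2%:R * (p == 0)%:R) *: t.
Proof.
move=> p0; apply: etrans (onBos_tens u _ y (lD p)) _.
by rewrite (dF_vac k a p0) (linZ (tens_linear2 u y)).
Qed.

Lemma curE_eval (s : nat) : (forall i, - s%:Z <= i -> chi i y = 0) ->
  curE (- s%:Z - 1) t =
  tens (par u) (bos_vac (a + k^-1)) (chi (- s%:Z - 1) y).
Proof.
move=> cy.
apply: etrans (nop_single fFchi (fFV k^-1) (FchiV k^-1) (i0 := - s%:Z - 1) _) _.
  move=> i ni; have [i_gt|i_le] := ltP (- s%:Z - 1) i; last first.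
    apply: etrans (congr1 (Fchi i) (FV_t0 _ _)) _; first by lia.
    exact: lin0 (fFchi.1 i).
  apply: etrans (FchiV _ _ _ _) _.
  apply: etrans (congr1 (FV _ _) (Fchi_t0 (cy _ _))) _; first by lia.
  exact: lin0 ((fFV _).1 _).
have -> : - s%:Z - 1 - 1 - (- s%:Z - 1) = -1 by lia.
by apply: etrans (congr1 (Fchi _) (FV_t1 _)) _; apply: onFer_tens.
Qed.

Lemma curF_eval (s n : nat) (h : C) : (n <= s)%N ->
  (forall i, - n%:Z < i -> X i u = 0) ->
  (forall i, - s%:Z <= i -> chi i y = 0) ->
  (forall i, 0 < i -> H i u = 0) -> H 0 u = h *: u ->
  chi (- n%:Z - 1) y = 0 \/ be * (k * a / 2%:R) + ga * h + de * n%:R = 0 ->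
  curF (- n%:Z) t =
  al *: tens (X (- n%:Z) u) (bos_vac (a - k^-1)) y.
Proof.
move=> ns Xu cy Hu H0u cond.
have Xt i : FX i t = tens (X i u) (bos_vac a) y by exact: onV_tens.
have Ht i : FH i t = tens (H i u) (bos_vac a) y by exact: onV_tens.
apply: etrans (odd_cur_eval al be ga de fFX fFH fFD (fFV (- k^-1)) fFchi
  FchiH FchiD (FchiV _) (FXV _) (FHV _) (d := k * a / 2%:R) (h := h) ns _ _ _ _ _ _ _) _.
- by move=> p; apply: FV_t0.
- by move=> i /Xu Xi; rewrite Xt Xi; exact: lin0 (tens_linear1 _ _).
- by move=> i /cy; apply: Fchi_t0.
- by move=> i /Hu Hi; rewrite Ht Hi; exact: lin0 (tens_linear1 _ _).
- by rewrite Ht H0u; exact: (linZ (tens_linear1 _ _)).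
- move=> i i0; apply: etrans (FD_t (ltW i0)) _.
  have -> : (i == 0) = false by lia.
  by rewrite mulr0 scale0r.
- by apply: etrans (FD_t (lexx 0)) _; rewrite eqxx mulr1.
apply: etrans (congr2 (fun p q => al *: FX (- n%:Z) p + _ *: q) (FV_t1 _) _) _.
  reflexivity.
have -> : FX (- n%:Z) (tens u (bos_vac (a - k^-1)) y) =
    tens (X (- n%:Z) u) (bos_vac (a - k^-1)) y by exact: onV_tens.
case: cond => [c0|->]; last by rewrite scale0r addr0.
rewrite (Fchi_t0 c0) (lin0 ((fFV _).1 _)).
by rewrite scaler0 addr0.
Qed.

End Evaluation.

Section Strings.
Variables (a h : C) (v : V) (y : fer C).
Hypothesis Xv : forall i, 0 < i -> X i v = 0.
Hypothesis Hv : forall i, 0 < i -> H i v = 0.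
Hypothesis H0v : H 0 v = h *: v.
Hypothesis parv : par v = - v.
Hypothesis chiy : forall i, 0 <= i -> chi i y = 0.

Let kill_chi s i : - s%:Z <= i -> chi i (down chi (-1) s y) = 0.
Proof.
have chiy' l : -1 < l -> chi l y = 0 by move=> l0; apply: chiy; lia.
by move=> si; apply: (down_kill lchi chichi chiy'); lia.
Qed.

(** Each mode of E carries one fermion across the odd vector v, whence the sign, and raises the
    momentum by 1/k. *)
Lemma down_curE s : down curE (-1) s (tens v (bos_vac a) y) =
  (-1) ^+ s *: tens v (bos_vac (a + s%:R / k)) (down chi (-1) s y).
Proof.
elim: s => [|s IH] /=; first by rewrite mul0r addr0 scale1r.
rewrite IH (linZ (curE_linear _)) (_ : -1 - s%:Z = - s%:Z - 1); last by lia.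
rewrite curE_eval; last exact: kill_chi.
rewrite parv (linN (tens_linear1 _ _)) exprS mulN1r scaleNr scalerN.
by rewrite -natr1 mulrDl mul1r addrA.
Qed.

(** When the extra factor acts, s modes of F have already lowered the momentum b by s/k and changed
    the charge h by e s; these are the values in the condition. *)
Lemma down_curF s t b : (t <= s)%N \/ t = s.+1 /\
    be * (k * (b - s%:R / k) / 2%:R) + ga * (h + e * s%:R) + de * s%:R = 0 ->
  down curF 0 t (tens v (bos_vac b) (down chi (-1) s y)) =
  al ^+ t *: tens (down X 0 t v) (bos_vac (b - t%:R / k)) (down chi (-1) s y).
Proof.
elim: t => [|t IH] ts /=; first by rewrite mul0r subr0 scale1r.
have ts' : (t <= s)%N by case: ts => [|[]]; lia.
rewrite IH; last by left.
rewrite (linZ (curF_linear _)) sub0r.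
have [Hi H0] := down_weight t lX lH XX HX Xv Hv H0v.
rewrite (@curF_eval _ _ _ s t (h + e * t%:R))//.
- by rewrite scalerA -exprSr -natr1 mulrDl mul1r opprD addrA.
- by move=> i ti; apply: (down_kill (c := 0)) => //; lia.
- exact: kill_chi.
- have [st|] := ltnP t s; first by left; apply: kill_chi; lia.
  by move=> st; right; case: ts => [|[[->]]]; first lia.
Qed.

(** With E moved to the right, F starts from the momentum a + s/k; the s modes before the extra one
    bring it back to a, so the condition involves a alone. *)
Lemma down_curE_curF s t : (t <= s)%N \/ t = s.+1 /\
    be * (k * a / 2%:R) + ga * (h + e * s%:R) + de * s%:R = 0 ->
  down curE (-1) s (down curF 0 t (tens v (bos_vac a) y)) =
  ((-1) ^+ (s * t + s) * al ^+ t) *: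
    tens (down X 0 t v) (bos_vac (a + s%:R / k - t%:R / k)) (down chi (-1) s y).
Proof.
move=> cond; rewrite (down_swap _ _ _ _ _ curE_linear curF_linear curE_curF).
rewrite down_curE.
have lF : linear (down curF 0 t).
  elim: t {cond} => [|t IH] /=; first exact: linear_id.
  exact: linear_comp (curF_linear _) IH.
rewrite (linZ lF) down_curF ?addrK// !scalerA exprD; congr (_ *: _).
Qed.

End Strings.

End Realized.

Lemma sub_combination (C : pzRingType) (T : lmodType C) (c d : C) (w x y z : T) :
  w - x - c *: y - d *: z = 1 *: w + (-1) *: x + (- c) *: y + (- d) *: z.
Proof. by rewrite scale1r scaleN1r !scaleNr. Qed.

Lemma mixed_combination (C : pzRingType) (T : lmodType C) (b c d : C) (w x y z : T) :
  b *: w + x - c *: y + d *: z = b *: w + 1 *: x + (- c) *: y + d *: z.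
Proof. by rewrite scale1r !scaleNr. Qed.

(** * The charged singular vectors *)

Section ChargedVectors.
Context {C : numFieldType} (k j h l : C) {V : lmodType C}.
Variables (rho : n2rep (- 3%:R - 6%:R * k) V) (v : V).
Hypothesis v_verma : n2_verma rho h l v.

Let sm u : smooth rho u. Proof. exact: verma_smooth v_verma. Qed.

Lemma isfield_n2H : isfield (n2H rho).
Proof.
split=> [n|u]; first exact: linearP.
by have [N uN] := sm u; exists N%:Z => n /uN[].
Qed.

Lemma isfield_n2G : isfield (fun n => n2G rho (n - 1)).
Proof.
split=> [n|u]; first exact: linearP.
have [N uN] := sm u; exists (N%:Z + 1) => n Nn.
by have [] := uN (n - 1) ltac:(lia).
Qed.

Lemma isfield_n2Q : isfield (n2Q rho).
Proof.
split=> [n|u]; first exact: linearP.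
by have [N uN] := sm u; exists N%:Z => n /uN[].
Qed.

Let linpar : linear (n2par rho). Proof. exact: linearP. Qed.

Let acomm0 (A B : V -> V) u : acomm A B u = 0 -> A (B u) = - B (A u).
Proof. by move=> /n2_aswap ->; rewrite addr0. Qed.

Lemma charged_G (N : nat) :
  modes (curE2 rho) (-1 - N%:Z + 1) (-1)
    (modes (curF1 rho) (0 - N%:Z + 1) 0 (ramond_hw k j v)) =
  tens (modes (n2G rho) (-1 - N%:Z + 1) (-1) v) (bos_vac (2%:R * j / k))
    (modes (@psibar C) (-1 - N%:Z + 1) (-1) (fer_vac C)).
Proof.
have [Qv Gv LHv [H0v L0v] parv] := v_verma.1.
(* G has conformal weight 2, so its mode n in the z^(-n-1) convention is G_(n-1), and X_(1-N) ...
   X_0 is G_(-N) ... G_(-1). *)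
pose X n : V -> V := n2G rho (n - 1).
have -> : curE2 rho = curE k (n2par rho) (@psibar C) by [].
have -> : curF1 rho = curF k (n2par rho) X (n2H rho) (@psibar C)
    1 (-1) (- 2%:R^-1) (- (k + 2%:R^-1)).
  by apply/funext => n; apply/funext => w; apply: sub_combination.
have parX n u : n2par rho (X n u) = - X n (n2par rho u) by exact: n2parG.
have parH n u : n2par rho (n2H rho n u) = n2H rho n (n2par rho u).
  exact: n2parH.
have XX m n u : X m (X n u) = - X n (X m u) by apply: acomm0; apply: n2GG.
have HX m n u : n2H rho m (X n u) = X n (n2H rho m u) + 1 *: X (m + n) u.
  by rewrite scale1r /X -addrA; exact: (n2_swap (n2HG rho m (n - 1) u)).
have Xv i : 0 < i -> X i v = 0 by move=> i0; apply: Gv; lia.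
have Hv i : 0 < i -> n2H rho i v = 0 by move=> i0; have [] := LHv i i0.
rewrite !modes_down.
apply: etrans (down_curE_curF 1 linpar isfield_n2G isfield_n2H isfield_psibar
  (n2parK rho) parX parH XX HX psibar_anticomm Xv Hv H0v parv psibar_vac
  (or_introl (leqnn N))) _.
rewrite expr1n mulr1 addrK -signr_odd oddD oddM andbb addbb scale1r.
by have -> : down X 0 N v = down (n2G rho) (-1) N v :=
  down_shift (fun n => n2G rho n) (-1) 0 N v.
Qed.

(** The hypothesis on j and h says that j - (h - N)/2 + (k + 1/2) N = 0: at the extra factor F_(-N),
    dF_0 has eigenvalue j and H_0 has h - N. With one more F than E, the momentum ends 1/k lower. *)
Lemma charged_Q (N : nat) : k != 0 -> j - h / 2%:R + N%:R * (k + 1) = 0 ->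
  modes (curE1 rho) (-1 - N%:Z + 1) (-1)
    (modes (curF2 rho) (0 - N.+1%:Z + 1) 0 (ramond_hw k j v)) =
  ((-1) ^+ N * ((k + 1) / 2%:R) ^+ N.+1) *:
  tens (modes (n2Q rho) (0 - N.+1%:Z + 1) 0 v) (bos_vac ((2%:R * j - 1) / k))
    (modes (@psi C) (0 - N%:Z + 1) 0 (fer_vac C)).
Proof.
move=> k0 hN; have [Qv Gv LHv [H0v L0v] parv] := v_verma.1.
pose chi n : fer C -> fer C := @psi C (n + 1).
pose X n : V -> V := n2Q rho n.
have -> : curE1 rho = curE k (n2par rho) chi by [].
have -> : curF2 rho = curF k (n2par rho) X (n2H rho) chi
    ((k + 1) / 2%:R) 1 (- 2%:R^-1) (k + 2%:R^-1).
  by apply/funext => n; apply/funext => w; apply: mixed_combination.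
rewrite !modes_down.
have chi_vac i : 0 <= i -> chi i (fer_vac C) = 0.
  by move=> i0; apply: psi_vac; lia.
have parX n u : n2par rho (X n u) = - X n (n2par rho u) by exact: n2parQ.
have parH n u : n2par rho (n2H rho n u) = n2H rho n (n2par rho u).
  exact: n2parH.
have XX m n u : X m (X n u) = - X n (X m u) by apply: acomm0; apply: n2QQ.
have HX m n u : n2H rho m (X n u) = X n (n2H rho m u) + (-1) *: X (m + n) u.
  by rewrite scaleN1r; exact: (n2_swap (n2HQ rho m n u)).
have Xv i : 0 < i -> X i v = 0 by move=> i0; apply: Qv; lia.
have Hv i : 0 < i -> n2H rho i v = 0 by move=> i0; have [] := LHv i i0.
have chichi m n y : chi m (chi n y) = - chi n (chi m y) by exact: psi_anticomm.
have cond : 1 * (k * (2%:R * j / k) / 2%:R) + - 2%:R^-1 * (h + -1 * N%:R) +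
    (k + 2%:R^-1) * N%:R = 0.
  by rewrite -[RHS]hN; field; exact: k0.
apply: etrans (down_curE_curF ((k + 1) / 2%:R) linpar isfield_n2Q isfield_n2H
  isfield_psi (n2parK rho) parX parH XX HX chichi Xv Hv H0v parv chi_vac
  (or_intror (conj (erefl N.+1) cond))) _.
have -> : (-1) ^+ (N * N.+1 + N) = (-1) ^+ N :> C.
  rewrite -[LHS]signr_odd -[RHS]signr_odd oddD oddM /=.
  by case: (odd N).
have -> : 2%:R * j / k + N%:R / k - N.+1%:R / k = (2%:R * j - 1) / k.
  by rewrite -natr1; field; exact: k0.
by have -> : down chi (-1) N (fer_vac C) = down (@psi C) 0 N (fer_vac C) :=
  down_shift (@psi C) 1 (-1) N (fer_vac C).
Qed.

End ChargedVectors.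

Theorem theorem5p2 (R : realType) (k j p l : R[i]) (r : int)
    (k_neq0 : k != 0) (k_neqN1 : k != -1)
    (p_def : p = p2 r j k) (l_def : l = lch (- r) (k - 2%:R * p) k)
    (V : lmodType R[i]) (rho : n2rep (- 3%:R - 6%:R * k) V) (v : V)
    (v_verma : n2_verma rho (k - 2%:R * p) l v) :
  [/\ l = - ((j + p - k / 2%:R) * (1 - j + k / 2%:R + p) / (1 + k)),
      r <= -1 ->
        chargedII rho r j v =
        tens (modes (n2G rho) r (-1) v)
             (bos_vac (2%:R * j / k))
             (modes (@psibar R[i]) r (-1) (fer_vac R[i]))
    & 0 <= r ->
        chargedII rho r j v =
        ((-1) ^ r * ((k + 1) / 2%:R) ^ (r + 1)) *:
        tens (modes (n2Q rho) (- r) 0 v)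
             (bos_vac ((2%:R * j - 1) / k))
             (modes (@psi R[i]) (- r + 1) 0 (fer_vac R[i]))].
Proof.
split.
(* By the choice of p, j + p - k/2 equals - r (k + 1), which cancels the denominator. *)
- have k1 : 1 + k != 0 by rewrite addrC addr_eq0.
  rewrite l_def /lch p_def /p2 !intrD !mulrNz; move: (r%:~R : R[i]) => s.
  by field.
- move=> r1; rewrite /chargedII r1.
  have [N rN] : exists N : nat, r = -1 - N%:Z + 1 by exists (absz r); lia.
  have -> : r + 1 = 0 - N%:Z + 1 by lia.
  by rewrite rN; exact: (charged_G j v_verma).
- move=> r0; rewrite /chargedII (_ : (r <= -1) = false); last by lia.
  have [N rN] : exists N : nat, r = N%:Z by exists (absz r); lia.
  (* For N = r this is the equation p = p2 r j k, solved for 0. *)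
  have cond : j - (k - 2%:R * p) / 2%:R + N%:R * (k + 1) = 0.
    rewrite p_def /p2 rN -[(N%:Z)%:~R]/(N%:R : R[i]).
    by move: (N%:R : R[i]) => s; field.
  have := charged_Q v_verma k_neq0 cond.
  have -> : 0 - N.+1%:Z + 1 = - r by lia.
  have -> : 0 - N%:Z + 1 = - r + 1 by lia.
  have -> : -1 - N%:Z + 1 = - r by lia.
  have -> : (-1) ^+ N * ((k + 1) / 2%:R) ^+ N.+1 =
      (-1) ^ r * ((k + 1) / 2%:R) ^ (r + 1) :> R[i].
    by rewrite rN -PoszD addn1.
  exact.
Qed.
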